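(* (Basic Double Linkage for arrangements.) Let $\mathcal A_f$ be a hypersurface arrangement in $\mathbb P^n$ defined by $f=f_1\cdots f_s$. Let $g$ be a homogeneous polynomial. Assume: (i) each complete intersection of the form $(f_i,g)$ is smooth; (ii) each complete intersection of the form $(f_i,f_j)$ with $i\neq j$ is smooth; (iii) $\operatorname{codim}(f_i,f_j,g)=3$ whenever $i\neq j$. Then the following hold: (a) $$\mathrm{Jac}(fg)^{top}=\mathrm{Jac}(f)^{top}\cap\Big[\bigcap_{i}(f_i,g)\Big],$$ where $\bigcap_i(f_i,g)=(f,g)$; (b) $\mathrm{Jac}(fg)^{top}=g\cdot\mathrm{Jac}(f)^{top}+(f)$; in particular, $\mathrm{Jac}(fg)^{top}$ is obtained from $\mathrm{Jac}(f)^{top}$ by Basic Double Linkage; (c) statements (a) and (b) continue to hold if $\mathrm{Jac}(fg)^{top}$ and $\mathrm{Jac}(f)^{top}$ are replaced by their radicals.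
   Context: $K$ is an algebraically closed field of characteristic zero and $S=K[x_0,\dots,x_n]$ is the coordinate ring of $\mathbb P^n$. A hypersurface arrangement defined by $f=f_1\cdots f_s$ is the union of the distinct hypersurfaces defined by the forms $f_i\in S$. For a form $h$, $\mathrm{Jac}(h)=\left(\frac{\partial h}{\partial x_0},\dots,\frac{\partial h}{\partial x_n}\right)$, and $\mathrm{Jac}(h)^{top}$ is the intersection of the primary components of codimension (height) two in a primary decomposition of $\mathrm{Jac}(h)$ (equal to $S$ if there are none). $\operatorname{codim}(\cdot)$ is the codimension (height) of the ideal in $S$. Complete intersections $(f_i,g)$ and $(f_i,f_j)$ are understood to be of codimension two. Basic Double Linkage: given the saturated ideal $I_{V_1}$ of a locally Cohen-Macaulay, equidimensional codimension two subscheme $V_1\subset\mathbb P^n$ (or $I_{V_1}=S$) and a regular sequence $(F_1,F_2)$ of homogeneous polynomials with $F_1\in I_{V_1}$, one forms the ideal $F_2\cdot I_{V_1}+(F_1)$.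
   Formalization: Assumes n ≥ 2 and, when n = 2, that the curve g = 0 is smooth (a node of g off f contradicts (a)); for n ≥ 4, full Basic Double Linkage is claimed only if the scheme of Jac(f)^top (resp. its radical) is locally Cohen-Macaulay, which can fail; all else is unconditional. *)

(* Defs.v *)
From HB Require Import structures.
From mathcomp Require Export all_boot all_order all_algebra.
From mathcomp Require Export boolp classical_sets.
From mathcomp Require Export mpoly.

Set Implicit Arguments.
Unset Strict Implicit.
Unset Printing Implicit Defensive.

Import GRing.Theory.
Local Open Scope ring_scope.
Local Open Scope classical_set_scope.

(* Ideals are Prop-valued sets, since membership in a generated ideal is not
   boolean; [setT] is the unit ideal. *)
Section Ideals.
Variable R : comNzRingType.
Implicit Types (I J P Q A : set R) (s : seq R).

Definition is_ideal I : Prop :=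
  [/\ I 0, (forall a b, I a -> I b -> I (a + b)) & (forall r a, I a -> I (r * a))].

Definition ideal_gen A : set R :=
  [set x | forall I, is_ideal I -> A `<=` I -> I x].

Definition ideal_of s : set R := ideal_gen [set` s].

Definition is_prime P : Prop :=
  [/\ is_ideal P, ~ P 1 & forall a b, P (a * b) -> P a \/ P b].

Definition radical I : set R := [set x | exists k : nat, I (x ^+ k)].

Definition is_primary Q : Prop :=
  [/\ is_ideal Q, ~ Q 1 & forall a b, Q (a * b) -> Q a \/ radical Q b].

(* A strict chain p_0 < p_1 < ... < p_k = P of primes containing I. *)
Definition prime_chain I P (k : nat) : Prop :=
  exists p : nat -> set R,
    [/\ p k = P, I `<=` p 0%N,
        (forall i, (i <= k)%N -> is_prime (p i))
      & (forall i, (i < k)%N -> p i `<` p i.+1)].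

(* ht I = inf { ht P : P prime, I <= P }, where ht P is the supremum of the
   lengths of chains of primes ending at P. The unit ideal has height at least
   c for every c, so no finite codimension. *)
Definition height_ge I (c : nat) : Prop :=
  forall P, is_prime P -> I `<=` P -> prime_chain [set 0] P c.

Definition has_codim I (c : nat) : Prop := height_ge I c /\ ~ height_ge I c.+1.

(* Irredundant primary decomposition; m = 0 gives the unit ideal. *)
Definition primary_decomposition I (m : nat) (Q : 'I_m -> set R) : Prop :=
  [/\ I = \bigcap_(i in [set: 'I_m]) Q i,
      (forall i, is_primary (Q i)),
      (forall i j, radical (Q i) = radical (Q j) -> i = j)
    & (forall i, ~ (\bigcap_(j in [set j | j != i]) Q j `<=` Q i))].

(* T is the intersection of the height two components of some irredundant
   primary decomposition of I (the unit ideal if there are none). *)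
Definition is_top I (T : set R) : Prop :=
  exists (m : nat) (Q : 'I_m -> set R),
    primary_decomposition I Q /\
    T = \bigcap_(i in [set i | has_codim (Q i) 2]) Q i.

Definition is_minimal_prime I P : Prop :=
  [/\ is_prime P, I `<=` P
    & forall Q, is_prime Q -> I `<=` Q -> Q `<=` P -> Q = P].

Definition regular_sequence s : Prop :=
  (forall (k : nat) (a : R), (k < size s)%N ->
     ideal_of (take k s) (s`_k * a) -> ideal_of (take k s) a)
  /\ ~ ideal_of s 1.

(* The sequence s is regular on the localization of R / I at P: an element a
   vanishes in R_P / J_P iff t * a lies in J for some t outside P. *)
Definition locally_regular I P s : Prop :=
  forall (k : nat) (a : R), (k < size s)%N ->
    let J := ideal_gen (I `|` [set` take k s]) in
    (exists t, ~ P t /\ J (t * (s`_k * a))) -> exists t, ~ P t /\ J (t * a).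

Definition local_dim I P (d : nat) : Prop :=
  prime_chain I P d /\ ~ prime_chain I P d.+1.

(* R_P / I_P is Cohen-Macaulay: some regular sequence inside the maximal ideal
   has length the Krull dimension. Up to units such a sequence may be taken in
   P itself. *)
Definition CM_at I P : Prop :=
  exists s, [/\ [set` s] `<=` P, locally_regular I P s & local_dim I P (size s)].

End Ideals.

Section Projective.
Variables (K : closedFieldType) (n : nat).
Notation S := {mpoly K[n.+1]}.
Implicit Types (I J T P : set S) (f g h : S).

Definition jac h : set S := ideal_of [seq (h^`M(i) : S) | i <- enum 'I_n.+1].

Definition is_form h : Prop := exists d : nat, h \is d.-homog.

(* Zero locus in P^n, as a set of (nonzero) homogeneous coordinate vectors. *)
Definition zero_locus h : set ('I_n.+1 -> K) :=
  [set a | (exists i, a i != 0) /\ h.@[a] = 0].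

Definition hypersurface_arrangement (s : nat) (f : 'I_s -> S) : Prop :=
  (forall i, f i != 0 /\ exists2 d : nat, (0 < d)%N & f i \is d.-homog) /\
  injective (fun i => zero_locus (f i)).

(* The forms in F define a complete intersection of codimension c = size F
   which is smooth over K: the Jacobian matrix has rank c at each closed point
   of the subscheme of P^n. *)
Definition smooth_complete_intersection (c : nat) (F : c.-tuple S) : Prop :=
  has_codim (ideal_of F) c /\
  forall a : 'I_n.+1 -> K, (exists i, a i != 0) ->
    (forall k, (tnth F k).@[a] = 0) ->
    \rank (\matrix_(k < c, j < n.+1) ((tnth F k)^`M(j) : S).@[a]) = c.

Definition homogeneous_ideal I : Prop :=
  is_ideal I /\ forall h (d : nat), I h -> I (pihomog mdeg d h).

(* I is equal to the union over k of I : m^k, m the irrelevant ideal. *)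
Definition saturated I : Prop :=
  forall h, (exists k : nat,
               forall m : 'X_{1..n.+1}, mdeg m = k -> I ('X_[m] * h)) -> I h.

(* The saturated ideal of an equidimensional codimension two subscheme. *)
Definition codim_two_ideal I : Prop :=
  [/\ homogeneous_ideal I, saturated I, ~ I 1
    & forall P, is_minimal_prime I P -> has_codim P 2].

(* Points of the scheme P^n: homogeneous primes other than the irrelevant
   one. The local ring of the affine cone at such a prime is a localized
   polynomial extension of the one of the projective scheme, so one is
   Cohen-Macaulay iff the other is. *)
Definition locally_CM I : Prop :=
  forall P, is_prime P -> homogeneous_ideal P -> I `<=` P ->
    (exists i, ~ P 'X_i) -> CM_at I P.

(* The ideal F2 * I + (F1). *)
Definition double_link_ideal I (F1 F2 : S) : set S :=
  [set h | exists2 q, I q & exists r, h = F2 * q + r * F1].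

(* The construction, with its conditions on F1 and F2 but without those on I. *)
Definition double_link_step I (F1 F2 : S) J : Prop :=
  [/\ is_form F1 /\ is_form F2, regular_sequence [:: F1; F2], I F1
    & J = double_link_ideal I F1 F2].

Definition basic_double_linkage I (F1 F2 : S) J : Prop :=
  (I = setT \/ (codim_two_ideal I /\ locally_CM I)) /\
  double_link_step I F1 F2 J.

End Projective.

(* Main.v *)
(** Locally at a prime P of height two containing g, either f is a unit and
    Jac(f g) is trivial because g is smooth there, or exactly one f_i lies in P;
    then some 2 x 2 minor of the Jacobian matrix of (f_i, g) is a unit and
    Cramer's rule gives Jac(f g) = (f_i, g) = (f, g), while Jac(f) is trivial.
    If g is not in P then Jac(f g) = Jac(f) and (f, g) is trivial. Since the
    complete intersection (f, g) is unmixed, Jac(f g)^top is the intersection of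
    Jac(f)^top and (f, g); it equals g Jac(f)^top + (f) because g is regular
    modulo Jac(f)^top.

    Dimension theory of polynomial rings enters through transcendence degrees:
    a prime P of K[X_1, ..., X_m] has k local generators, a chain of length k
    below it and m - k elements algebraically independent modulo it, and k is
    maximal by a dimension count. Unmixedness holds because K[X]/(f, g) is
    torsion free over a polynomial subring in two variables fewer. *)

From mathcomp Require Import zify ring.
Require Import Defs.

Set Implicit Arguments.
Unset Strict Implicit.
Unset Printing Implicit Defensive.

Import GRing.Theory.
Local Open Scope ring_scope.
Local Open Scope classical_set_scope.

(** * Ideals, primes and chains of primes *)

(** Since [jac f] and [jac (f * g)] have height at least two, their height two primary components
    are isolated. The top part is therefore independent of the chosen decomposition: it is the
    intersection, over the height two primes P, of the preimages [loc I P] of the localizations, and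
    the claims become equalities of such preimages. The height bound is geometric. Smoothness of
    (f_i, g) makes the singular locus of f_i miss g = 0, so this locus is finite in projective space
    and every prime over [jac (f_ i)] has height at least n. The same holds for [jac g]; for n = 2
    this leaves room for height two primes over [jac g], which [g_smooth] excludes. The given
    primary components are not assumed homogeneous. Homogeneity of the top part comes from its
    stability under X_i |-> 2 X_i, the powers of 2 being distinct in characteristic zero. Passing to
    radicals works because (f, g) is itself radical. For n <= 3 a homogeneous prime other than the
    irrelevant one has height at most three, so the local dimension along a codimension two scheme
    is at most one, where purity implies the Cohen-Macaulay property. *)

Section IdealTheory.
Variable R : comNzRingType.
Implicit Types (I J P Q A M : set R) (s : seq R) (a b x : R).

Lemma ideal0 I : is_ideal I -> I 0. Proof. by case. Qed.
Lemma idealD I a b : is_ideal I -> I a -> I b -> I (a + b).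
Proof. by case=> _ + _; apply. Qed.
Lemma idealMl I a b : is_ideal I -> I b -> I (a * b).
Proof. by case=> _ _; apply. Qed.
Lemma idealMr I a b : is_ideal I -> I a -> I (a * b).
Proof. by rewrite mulrC; apply: idealMl. Qed.
Lemma idealN I a : is_ideal I -> I a -> I (- a).
Proof. by move=> ? ?; rewrite -mulN1r; apply: idealMl. Qed.
Lemma idealB I a b : is_ideal I -> I a -> I b -> I (a - b).
Proof. by move=> ? ? ?; apply: idealD => //; apply: idealN. Qed.
Lemma ideal_addr I a b : is_ideal I -> I b -> I (a + b) -> I a.
Proof. by move=> iI Ib /(fun h => idealB iI h Ib); rewrite addrK. Qed.
Lemma ideal_sum I (T : Type) (r : seq T) (p : pred T) (F : T -> R) :
  is_ideal I -> (forall i, p i -> I (F i)) -> I (\sum_(i <- r | p i) F i).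
Proof.
by move=> iI IF; elim/big_rec: _ => [|i x pi Ix]; [exact: ideal0 | apply: idealD => //; exact: IF].
Qed.
Lemma ideal_setT I : is_ideal I -> I 1 -> I = setT.
Proof. by move=> iI I1; apply/seteqP; split=> // x _; rewrite -[x]mulr1; apply: idealMl. Qed.

Lemma zero_ideal : is_ideal [set (0 : R)].
Proof. by split=> [|a b /= -> ->|r a /= ->]; rewrite ?addr0 ?mulr0. Qed.

Lemma ideal_bigcap T (D : set T) (F : T -> set R) :
  (forall i, D i -> is_ideal (F i)) -> is_ideal (\bigcap_(i in D) F i).
Proof.
move=> iF; split=> [i Di|a b Ia Ib i Di|r a Ia i Di]; have iFi := iF _ Di.
- exact: ideal0.
- by apply: idealD => //; [apply: Ia | apply: Ib].
- by apply: idealMl => //; apply: Ia.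
Qed.

Lemma ideal_gen_ideal A : is_ideal (ideal_gen A).
Proof.
split=> [I iI _|a b Ia Ib I iI AI|r a Ia I iI AI]; first exact: ideal0.
  by apply: idealD => //; [apply: Ia | apply: Ib].
by apply: idealMl => //; apply: Ia.
Qed.

Lemma sub_ideal_gen A : A `<=` ideal_gen A.
Proof. by move=> x Ax I _; apply. Qed.

Lemma ideal_gen_min A I : is_ideal I -> A `<=` I -> ideal_gen A `<=` I.
Proof. by move=> iI AI x; apply. Qed.

Lemma ideal_of_ideal s : is_ideal (ideal_of s).
Proof. exact: ideal_gen_ideal. Qed.

Lemma mem_ideal_of s x : x \in s -> ideal_of s x.
Proof. by move=> sx; apply: sub_ideal_gen. Qed.

Lemma ideal_of_min s I : is_ideal I -> {in s, forall x, I x} -> ideal_of s `<=` I.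
Proof. by move=> iI sI; apply: ideal_gen_min. Qed.

Lemma ideal_of_nil (x : R) : ideal_of ([::] : seq R) x <-> x = 0.
Proof.
split=> [|->]; last exact: ideal0 (ideal_of_ideal _).
by move/(_ _ zero_ideal); apply.
Qed.

Lemma ideal_of_cons a s x :
  ideal_of (a :: s) x <-> exists u, exists2 v, ideal_of s v & x = u * a + v.
Proof.
split=> [|[u [v sv ->]]].
  move/(_ [set x | exists u, exists2 v, ideal_of s v & x = u * a + v]); apply; last first.
    move=> y /=; rewrite inE => /predU1P[->|ys]; last first.
      by exists 0, y; [exact: mem_ideal_of | rewrite mul0r add0r].
    exists 1, 0; last by rewrite mul1r addr0.
    exact: ideal0 (ideal_of_ideal _).
  have iS := ideal_of_ideal s; split=> [|b c [u [v sv ->]] [u' [v' sv' ->]]|r b [u [v sv ->]]].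
  - by exists 0, 0; rewrite ?mul0r ?addr0 //; exact: ideal0.
  - by exists (u + u'), (v + v'); [apply: (idealD iS) | rewrite mulrDl addrACA].
  - by exists (r * u), (r * v); [apply: (idealMl _ iS) | rewrite mulrDr mulrA].
have iS := ideal_of_ideal (a :: s); apply: (idealD iS).
  by apply: (idealMl _ iS); apply: mem_ideal_of; rewrite mem_head.
apply: ideal_of_min sv => //.
by move=> y ys; apply: mem_ideal_of; rewrite inE ys orbT.
Qed.

Lemma ideal_of1 a x : ideal_of [:: a] x <-> exists u, x = u * a.
Proof.
split=> [/ideal_of_cons[u [v /ideal_of_nil -> ->]]|[u ->]]; first by exists u; rewrite addr0.
by apply/ideal_of_cons; exists u, 0; [exact/ideal_of_nil | rewrite addr0].
Qed.

Lemma ideal_of2 a b x : ideal_of [:: a; b] x <-> exists u v, x = u * a + v * b.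
Proof.
split=> [/ideal_of_cons[u [v /ideal_of1[w ->] ->]]|[u [v ->]]]; first by exists u, w.
by apply/ideal_of_cons; exists u, (v * b) => //; apply/ideal_of1; exists v.
Qed.

Lemma prime_ideal P : is_prime P -> is_ideal P. Proof. by case. Qed.
Lemma prime1 P : is_prime P -> ~ P 1. Proof. by case. Qed.
Lemma primeM P a b : is_prime P -> P (a * b) -> P a \/ P b.
Proof. by case=> _ _; apply. Qed.
Lemma primeNM P a b : is_prime P -> ~ P a -> ~ P b -> ~ P (a * b).
Proof. by move=> pP ? ? /(primeM pP)[]. Qed.
Lemma primeX P a k : is_prime P -> P (a ^+ k) -> P a.
Proof.
move=> pP; elim: k => [/(prime1 pP)//|k IH]; rewrite exprS.
by case/(primeM pP).
Qed.
Lemma primeNX P a k : is_prime P -> ~ P a -> ~ P (a ^+ k).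
Proof. by move=> pP nPa /(primeX pP). Qed.
Lemma primeN_prod P (T : eqType) (r : seq T) (p : pred T) (F : T -> R) :
  is_prime P -> (forall i, i \in r -> p i -> ~ P (F i)) ->
  ~ P (\prod_(i <- r | p i) F i).
Proof.
move=> pP nF; rewrite big_seq_cond.
elim/big_rec: _ => [|i x /andP[ri pi] nx]; first exact: prime1.
by apply: primeNM => //; apply: nF.
Qed.
Lemma prime_prod P (T : finType) (p : pred T) (F : T -> R) :
  is_prime P -> P (\prod_(i | p i) F i) -> exists2 i, p i & P (F i).
Proof.
move=> pP PF; apply: contrapT => nF; apply: primeN_prod (PF) => // i _ pi Pi.
by apply: nF; exists i.
Qed.

Lemma sub_radical I : I `<=` radical I.
Proof. by move=> x Ix; exists 1%N. Qed.

Lemma radical_ideal I : is_ideal I -> is_ideal (radical I).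
Proof.
move=> iI; split=> [|a b [k Ia] [l Ib]|r a [k Ia]].
- by exists 1%N; rewrite expr1; exact: ideal0.
- exists (k + l)%N; rewrite exprDn; apply: ideal_sum => // i _.
  rewrite -mulr_natr; apply: idealMr => //.
  have [li|li] := leqP k (k + l - i).
    by apply: idealMr => //; rewrite -(subnKC li) exprD; apply: idealMr.
  have li' : (l <= i)%N by lia.
  by apply: idealMl => //; rewrite -(subnKC li') exprD; apply: idealMr.
- by exists k; rewrite exprMn; apply: idealMl.
Qed.

Lemma radical_prime_sub I P : is_prime P -> I `<=` P -> radical I `<=` P.
Proof. by move=> pP IP x [k /IP /(primeX pP)]. Qed.

Lemma primary_ideal Q : is_primary Q -> is_ideal Q. Proof. by case. Qed.

Lemma primary_radical_prime Q : is_primary Q -> is_prime (radical Q).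
Proof.
move=> [iQ Q1 QM]; split; first exact: radical_ideal.
  by case=> k; rewrite expr1n.
move=> a b [k]; rewrite exprMn => /QM[Qa|[l Qb]]; first by left; exists k.
by right; exists (k * l)%N; rewrite exprM.
Qed.

Lemma prime_radical P : is_prime P -> radical P = P.
Proof.
by move=> pP; apply/seteqP; split; [exact: radical_prime_sub | exact: sub_radical].
Qed.

Lemma prime_primary P : is_prime P -> is_primary P.
Proof. by move=> pP; case: (pP) => iP P1 PM; split=> //; rewrite prime_radical. Qed.

Lemma radical_setI I J : is_ideal I -> is_ideal J -> radical (I `&` J) = radical I `&` radical J.
Proof.
move=> iI iJ; apply/seteqP; split=> [x [k [Ix Jx]]|x [[k Ix] [l Jx]]].
  by split; exists k.
by exists (k + l)%N; split; rewrite exprD; [apply: idealMr | apply: idealMl].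
Qed.

(* The preimage in R of the localization of I at P. *)
Definition loc I P : set R := [set x | exists t, ~ P t /\ I (t * x)].

Lemma sub_loc I P : is_prime P -> I `<=` loc I P.
Proof. by move=> pP x Ix; exists 1; rewrite mul1r; split=> //; exact: prime1. Qed.

Lemma loc_ideal I P : is_prime P -> is_ideal I -> is_ideal (loc I P).
Proof.
move=> pP iI; split=> [|a b [t [nt It]] [u [nu Iu]]|r a [t [nt It]]].
- by apply: sub_loc => //; exact: ideal0.
- exists (t * u); split; first exact: primeNM.
  rewrite mulrDr {1}[t * u]mulrC -!mulrA.
  by apply: idealD => //; apply: idealMl.
- by exists t; rewrite mulrCA; split=> //; apply: idealMl.
Qed.

Lemma locM I P t x : is_prime P -> ~ P t -> loc I P (t * x) -> loc I P x.
Proof.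
move=> pP nt [u [nu Iu]]; exists (u * t); rewrite -mulrA; split=> //.
exact: primeNM.
Qed.

Lemma loc_sub I J P : is_prime P -> I `<=` loc J P -> loc I P `<=` loc J P.
Proof. by move=> pP IJ x [t [nt /IJ]]; apply: locM. Qed.

Lemma loc_out I P t x : is_prime P -> is_ideal I -> I t -> ~ P t -> loc I P x.
Proof. by move=> pP iI It nt; exists t; split=> //; apply: idealMr. Qed.

(** Finitely many denominators have a common multiple outside P, their product, so localization
    commutes with finite intersections. *)
Lemma loc_seq P (T : finType) (p : pred T) (F : T -> set R) x : is_prime P ->
  (forall i, p i -> is_ideal (F i)) -> (forall i, p i -> loc (F i) P x) ->
  exists t, ~ P t /\ forall i, p i -> F i (t * x).
Proof.
move=> pP iF Fx.
have /choice[t tP] : forall i, exists t, ~ P t /\ (p i -> F i (t * x)).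
  move=> i; case pi: (p i); last by exists 1; split=> //; exact: prime1.
  by have [t [nt Ft]] := Fx _ pi; exists t.
exists (\prod_i t i); split; first by apply: primeN_prod => // i _ _; case: (tP i).
move=> i pi; rewrite (bigD1 i) //= mulrAC.
by apply: idealMr (iF _ pi) _; apply: (tP i).2.
Qed.

Lemma prime_bigcap P (T : finType) (p : pred T) (F : T -> set R) : is_prime P ->
  (forall i, p i -> is_ideal (F i)) ->
  \bigcap_(i in [set i | p i]) F i `<=` P -> exists2 i, p i & F i `<=` P.
Proof.
move=> pP iF FP; apply: contrapT => nF.
have [|t [nt Ft]] := @loc_seq P T p F 1 pP iF.
  move=> i pi; have /existsNP[t /not_implyP[Ft nPt]] : ~ F i `<=` P by move=> ?; apply: nF; exists i.
  by apply: loc_out Ft nPt => //; apply: iF.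
by apply: nt; rewrite -[t]mulr1; apply: FP => i; apply: Ft.
Qed.

(* An ideal maximal among those disjoint from a multiplicative set is prime. *)
Lemma prime_avoiding M I : is_ideal I -> M 1 -> (forall a b, M a -> M b -> M (a * b)) ->
  (forall x, M x -> ~ I x) ->
  exists P, [/\ is_prime P, I `<=` P & forall x, M x -> ~ P x].
Proof.
move=> iI M1 MM MI.
pose Z J := J = set0 \/ [/\ is_ideal J, I `<=` J & forall x, M x -> ~ J x].
have [|P [ZP maxP]] := @Zorn_bigcup R Z.
  move=> F FZ totF.
  have [[J FJ /set0P/negP J0]|F0] := pselect (exists2 J, F J & J !=set0); last first.
    left; apply/seteqP; split=> // x [J FJ Jx]; apply: F0; exists J => //; by exists x.
  have nz X x : F X -> X x -> [/\ is_ideal X, I `<=` X & forall x, M x -> ~ X x].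
    by move=> FX Xx; case: (FZ _ FX) => // X0; rewrite X0 in Xx.
  have [y Jy] : J !=set0 by apply/set0P/negP.
  have [iJ IJ MJ] := nz _ _ FJ Jy.
  right; split.
  - split=> [|a b [A FA Aa] [B FB Bb]|r a [A FA Aa]].
    + by exists J => //; exact: (ideal0 iJ).
    + have [iA _ _] := nz _ _ FA Aa; have [iB _ _] := nz _ _ FB Bb.
      case: (totF _ _ FA FB) => AB.
        by exists B => //; apply: idealD => //; apply: AB.
      by exists A => //; apply: idealD => //; apply: AB.
    + by have [iA _ _] := nz _ _ FA Aa; exists A => //; apply: idealMl.
  - by move=> x /IJ ?; exists J.
  - by move=> x Mx [A FA Ax]; have [_ _ /(_ _ Mx)] := nz _ _ FA Ax.
have [P0|[iP IP MP]] := ZP.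
  exfalso; apply: (maxP I); last by right; split.
  by rewrite P0; split=> // /(_ _ (ideal0 iI)).
exists P; split=> //; split=> //; first exact: MP.
have key a : ~ P a -> exists p r, P p /\ M (p + r * a).
  move=> nPa; apply: contrapT => nM.
  pose J : set R := [set x | exists p r, P p /\ x = p + r * a].
  apply: (maxP J).
    split=> [x Px|JP]; first by exists x, 0; rewrite mul0r addr0.
    by apply/nPa/JP; exists 0, 1; rewrite add0r mul1r; split=> //; exact: ideal0.
  right; split.
  - split=> [|x y [p [r [Pp ->]]] [p' [r' [Pp' ->]]]|u x [p [r [Pp ->]]]].
    + by exists 0, 0; rewrite mul0r addr0; split=> //; exact: ideal0.
    + by exists (p + p'), (r + r'); rewrite mulrDl addrACA; split=> //; apply: idealD.
    + by exists (u * p), (u * r); rewrite mulrDr mulrA; split=> //; apply: idealMl.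
  - by move=> x /IP Px; exists x, 0; rewrite mul0r addr0.
  - by move=> x Mx [p [r [Pp E]]]; apply: nM; exists p, r; rewrite -E.
move=> a b Pab; apply: contrapT => /not_orP[nPa nPb].
have [p [r [Pp Mp]]] := key _ nPa; have [q [u [Pq Mq]]] := key _ nPb.
apply: MP (MM _ _ Mp Mq) _; rewrite mulrDl; apply: idealD => //; first exact: idealMr.
rewrite mulrDr; apply: idealD => //; first exact: idealMl.
by rewrite mulrACA; apply: idealMl.
Qed.

Lemma prime_over I x : is_ideal I -> (forall k, ~ I (x ^+ k)) ->
  exists P, [/\ is_prime P, I `<=` P & ~ P x].
Proof.
move=> iI nx; have [| | | P [pP IP MP]] := @prime_avoiding [set x ^+ k | k in setT] I iI.
- by exists 0%N.
- by move=> _ _ [k _ <-] [l _ <-]; exists (k + l)%N; rewrite // exprD.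
- by move=> _ [k _ <-]; exact: nx.
by exists P; split=> //; apply: MP; exists 1%N.
Qed.

Lemma prime_chain0 I P : prime_chain I P 0 <-> is_prime P /\ I `<=` P.
Proof.
split=> [[p [<- Ip pp _]]|[pP IP]]; first by split=> //; apply: pp.
by exists (fun=> P); split.
Qed.

Lemma prime_chainS I P k : prime_chain I P k.+1 <->
  exists P', [/\ prime_chain I P' k, is_prime P & P' `<` P].
Proof.
split=> [[p [pk Ip pp ps]]|[P' [[p [pk Ip pp ps]] pP PP']]].
  exists (p k); split; [|by rewrite -pk; apply: pp|by rewrite -pk; apply: ps].
  exists p; split=> // i ik; [apply: pp | apply: ps]; exact: leqW.
exists (fun i => if (i <= k)%N then p i else P); split; rewrite ?ltnn //.
- by move=> i; case: ifP => // ik _; apply: pp.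
- move=> i ik; rewrite ltnS in ik; rewrite ik; case: ltngtP ik => // [ik _|-> _]; first exact: ps.
  by rewrite pk.
Qed.

Lemma prime_chain_prime I P k : prime_chain I P k -> is_prime P.
Proof. by case=> p [<- _ pp _]; apply: pp. Qed.

Lemma prime_chain_up I P P' k :
  prime_chain I P k -> is_prime P' -> P `<=` P' -> prime_chain I P' k.
Proof.
case: k => [/prime_chain0[_ IP] pP' PP'|k /prime_chainS[P0 [c _ [s1 s2]]] pP' PP'].
  by apply/prime_chain0; split=> //; apply: subset_trans PP'.
apply/prime_chainS; exists P0; split=> //; split; first exact: subset_trans PP'.
by move=> s3; apply: s2; apply: subset_trans s3.
Qed.

Lemma prime_chain_cat I P Q k l :
  prime_chain I P k -> prime_chain P Q l -> prime_chain I Q (k + l).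
Proof.
move=> cP; elim: l Q => [|l IH] Q.
  by case/prime_chain0=> pQ PQ; rewrite addn0; apply: prime_chain_up PQ.
case/prime_chainS=> Q' [/IH cQ' pQ sQ]; rewrite addnS.
by apply/prime_chainS; exists Q'.
Qed.

Lemma prime_chain_pred I P k : prime_chain I P k.+1 -> prime_chain I P k.
Proof.
by case/prime_chainS=> P' [cP' pP [sP _]]; apply: prime_chain_up sP.
Qed.

Lemma prime_chain_le I P k l : (k <= l)%N -> prime_chain I P l -> prime_chain I P k.
Proof.
move=> /subnK <-; elim: (l - k)%N => // m IH; rewrite addSn => /prime_chain_pred.
exact: IH.
Qed.

Definition ht2 P := [/\ is_prime P, prime_chain [set 0] P 2 & ~ prime_chain [set 0] P 3].

Lemma height_ge_radical I c : height_ge (radical I) c <-> height_ge I c.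
Proof.
split=> h P pP IP; apply: h => //; first exact: radical_prime_sub.
exact: subset_trans (@sub_radical _) IP.
Qed.

Lemma has_codim_radical I c : has_codim (radical I) c <-> has_codim I c.
Proof. by split=> -[h1 h2]; split; rewrite ?height_ge_radical // -height_ge_radical. Qed.

Lemma height_ge_prime P c : is_prime P -> height_ge P c <-> prime_chain [set 0] P c.
Proof.
move=> pP; split=> [|cP P' pP' PP']; first by apply.
exact: prime_chain_up PP'.
Qed.

Lemma has_codim2P Q : is_primary Q -> has_codim Q 2 <-> ht2 (radical Q).
Proof.
move=> /primary_radical_prime pQ; rewrite -has_codim_radical /has_codim !height_ge_prime //.
by split=> [[]|[]].
Qed.

End IdealTheory.

Arguments prime_avoiding {R} M {I}.

(** * Polynomial rings as iterated extensions *)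

Lemma mpoly_rmorph_ext (K : comNzRingType) m (A : comNzRingType)
    (u v : {rmorphism {mpoly K[m]} -> A}) :
  (forall c, u c%:MP = v c%:MP) -> (forall i, u 'X_i = v 'X_i) -> u =1 v.
Proof.
move=> uvC uvX h; rewrite [h]mpolyE !raddf_sum; apply: eq_bigr => mm _ /=.
rewrite -mul_mpolyC !rmorphM uvC mpolyXE_id !rmorph_prod; congr (_ * _).
by apply: eq_bigr => i _; rewrite !rmorphXn uvX.
Qed.

Lemma poly_rmorph_ext (B A : comNzRingType) (u v : {rmorphism {poly B} -> A}) :
  (forall c, u c%:P = v c%:P) -> u 'X = v 'X -> u =1 v.
Proof.
move=> uvC uvX; elim/poly_ind => [|p c IH]; first by rewrite !rmorph0.
by rewrite !rmorphD !rmorphM IH uvX uvC.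
Qed.

Section Shear.
Variables (K : comNzRingType) (m : nat) (a : 'I_m -> K).

(** With a = 0 this only singles out the last variable; a suitable a makes a given polynomial monic
    up to a unit, as in Noether normalization. *)
Definition shear_var (i : 'I_m.+1) : {poly {mpoly K[m]}} :=
  if unlift ord_max i is Some j then ('X_j)%:P + ((a j)%:MP)%:P * 'X else 'X.

Definition to_poly : {rmorphism {mpoly K[m.+1]} -> {poly {mpoly K[m]}}} :=
  mmap (@polyC _ \o @mpolyC m K) shear_var.

Definition of_coef : {rmorphism {mpoly K[m]} -> {mpoly K[m.+1]}} :=
  mmap (@mpolyC m.+1 K) (fun j => 'X_(lift ord_max j) - (a j)%:MP * 'X_ord_max).

Definition of_poly : {rmorphism {poly {mpoly K[m]}} -> {mpoly K[m.+1]}} :=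
  horner_eval 'X_ord_max \o map_poly of_coef.

Lemma to_polyC c : to_poly c%:MP = c%:MP%:P.
Proof. exact: mmapC. Qed.

Lemma to_polyX i : to_poly 'X_i = shear_var i.
Proof. by rewrite /= mmapX mmap1U. Qed.

Lemma of_coefC c : of_coef c%:MP = c%:MP.
Proof. exact: mmapC. Qed.

Lemma of_coefX j : of_coef 'X_j = 'X_(lift ord_max j) - (a j)%:MP * 'X_ord_max.
Proof. by rewrite /= mmapX mmap1U. Qed.

Lemma of_polyC c : of_poly c%:P = of_coef c.
Proof. by rewrite /of_poly /= map_polyC /horner_eval hornerC. Qed.

Lemma of_polyX : of_poly 'X = 'X_ord_max.
Proof. by rewrite /of_poly /= map_polyX /horner_eval hornerX. Qed.

Lemma to_polyK : cancel to_poly of_poly.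
Proof.
apply: (mpoly_rmorph_ext (u := of_poly \o to_poly) (v := idfun)) => [c|i].
  by rewrite -[LHS]/(of_poly (to_poly _)) to_polyC of_polyC of_coefC.
rewrite -[LHS]/(of_poly (to_poly _)) to_polyX /shear_var.
case: unliftP => [j ->|->]; last exact: of_polyX.
by rewrite rmorphD rmorphM !of_polyC of_polyX of_coefC of_coefX subrK.
Qed.

Lemma of_polyK : cancel of_poly to_poly.
Proof.
apply: (poly_rmorph_ext (u := to_poly \o of_poly) (v := idfun)) => [c|]; last first.
  by rewrite -[LHS]/(to_poly (of_poly _)) of_polyX to_polyX /shear_var unlift_none.
rewrite -[LHS]/(to_poly (of_poly _)) of_polyC -[RHS]/(c%:P).
apply: (mpoly_rmorph_ext (u := to_poly \o of_coef) (v := @polyC _)) => [d|j].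
  by rewrite -[LHS]/(to_poly (of_coef _)) of_coefC to_polyC.
rewrite -[LHS]/(to_poly (of_coef _)) of_coefX rmorphB rmorphM !to_polyX to_polyC.
by rewrite /shear_var liftK unlift_none addrK.
Qed.

End Shear.

Lemma preimage_ideal (A B : comNzRingType) (u : {rmorphism A -> B}) (I : set B) :
  is_ideal I -> is_ideal (u @^-1` I).
Proof.
move=> iI; split=> [|a b Ia Ib|r a Ia]; rewrite /preimage /=.
- by rewrite rmorph0; apply: (ideal0 iI).
- by rewrite rmorphD; apply: (idealD iI).
- by rewrite rmorphM; apply: (idealMl _ iI).
Qed.

Lemma preimage_prime (A B : comNzRingType) (u : {rmorphism A -> B}) (P : set B) :
  is_prime P -> is_prime (u @^-1` P).
Proof.
move=> pP; have [iP P1 PM] := pP; split; first exact: preimage_ideal.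
  by rewrite /preimage /= rmorph1.
by move=> a b; rewrite /preimage /= rmorphM; apply: PM.
Qed.

Lemma preimage_chain (A B : comNzRingType) (u : {rmorphism A -> B}) (P : set B) k :
  (forall y, exists x, u x = y) ->
  prime_chain [set 0] P k -> prime_chain [set 0] (u @^-1` P) k.
Proof.
move=> su; elim: k P => [|k IH] P.
  move=> /prime_chain0[pP P0]; apply/prime_chain0; split; first exact: preimage_prime.
  by move=> _ ->; rewrite /preimage /= rmorph0; apply: P0.
case/prime_chainS=> P' [/IH cP' pP [sP nsP]]; apply/prime_chainS; exists (u @^-1` P').
split=> //; first exact: preimage_prime.
split=> [x|sP']; first exact: sP.
by apply: nsP => y; have [x <-] := su y; apply: sP'.
Qed.

(** * Contraction and extension of primes between R and R[X] *)

Section PolyExtension.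
Variable R : comNzRingType.
Implicit Types (p : set R) (P Q : set {poly R}) (h : {poly R}).

Definition contract P : set R := (@polyC R) @^-1` P.
Definition extend p : set {poly R} := [set h | forall i, p h`_i].

Lemma extend_ideal p : is_ideal p -> is_ideal (extend p).
Proof.
move=> ip; split=> [i|g h pg ph i|g h ph i].
- by rewrite coef0; apply: (ideal0 ip).
- by rewrite coefD; apply: (idealD ip).
- by rewrite coefM; apply: (ideal_sum _ ip) => j _; apply: (idealMl _ ip).
Qed.

Lemma extendC p c : is_ideal p -> extend p c%:P <-> p c.
Proof.
move=> ip; split=> [/(_ 0%N)|pc i]; first by rewrite coefC.
by rewrite coefC; case: eqP => // _; apply: (ideal0 ip).
Qed.

Lemma first_out p h : ~ extend p h ->
  exists i, ~ p h`_i /\ forall j, (j < i)%N -> p h`_j.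
Proof.
move=> /existsNP[i0 ni0].
have ex : exists i, ~~ `[< p h`_i >] by exists i0; apply/asboolPn.
have [i /asboolPn ni mini] := ex_minnP ex; exists i; split=> // j ji.
apply: contrapT => nj.
by have := mini j (introT (asboolPn _) nj); rewrite leqNgt ji.
Qed.

(** As in Gauss's lemma: modulo p, the product of the lowest coefficients of g and h outside p is a
    coefficient of g h. *)
Lemma extend_prime p : is_prime p -> is_prime (extend p).
Proof.
move=> pp; have ip := prime_ideal pp; split; first exact: extend_ideal.
  by move/(_ 0%N); rewrite coef1; apply: prime1.
move=> g h pgh; apply: contrapT => /not_orP[/first_out[i [ngi gi]] /first_out[j [nhj hj]]].
apply: (primeNM pp ngi nhj); move: (pgh (i + j)%N); rewrite coefM.
have ii : (i < (i + j).+1)%N by lia.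
rewrite (bigD1 (Ordinal ii)) //= addKn => E; apply: (ideal_addr ip) E.
apply: (ideal_sum _ ip) => k; rewrite -val_eqE /= => ki.
have [ki'|ki'] := ltnP k i; first by apply: (idealMr _ ip); apply: gi.
by apply: (idealMl _ ip); apply: hj; have := ltn_ord k; lia.
Qed.

Lemma contract_prime P : is_prime P -> is_prime (contract P).
Proof. exact: preimage_prime. Qed.

Lemma poly_sum_coef h : h = \sum_(i < size h) (h`_i)%:P * 'X^i.
Proof. by rewrite -[LHS]coefK poly_def; apply: eq_bigr => i _; rewrite mul_polyC. Qed.

Lemma extend_contract P : is_ideal P -> extend (contract P) `<=` P.
Proof.
move=> iP h hP; rewrite [h]poly_sum_coef; apply: (ideal_sum _ iP) => i _.
by apply: (idealMr _ iP); apply: hP.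
Qed.

Lemma extend_chain p k : prime_chain [set 0] p k -> prime_chain [set 0] (extend p) k.
Proof.
elim: k p => [|k IH] p.
  move=> /prime_chain0[pp p0]; apply/prime_chain0; split; first exact: extend_prime.
  by move=> _ -> i; rewrite coef0; apply: p0.
case/prime_chainS=> p' [cp' pp [sp nsp]]; apply/prime_chainS; exists (extend p').
split; [exact: IH|exact: extend_prime|split=> [h ph i|sp']]; first exact: sp.
have ip' := prime_ideal (prime_chain_prime cp').
by apply: nsp => c pc; apply/extendC/sp'/extendC => //; exact: prime_ideal.
Qed.

(** A leading term with coefficient in p lies in the extension, hence in Q; subtracting such terms
    lowers the degree and must stop at a leading coefficient outside p. *)
Lemma lead_out p Q h : is_ideal p -> is_ideal Q -> extend p `<=` Q -> Q h -> ~ extend p h ->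
  exists2 g, Q g & ~ p (lead_coef g) /\ (size g <= size h)%N.
Proof.
move=> ip iQ pQ; have [k] := ubnP (size h); elim: k h => // k IH h hk Qh nh.
have [ph|] := pselect (p (lead_coef h)); last by exists h.
have eh : extend p ((lead_coef h)%:P * 'X^((size h).-1)).
  by move=> i; rewrite coefCM; apply: (idealMr _ ip).
have h0 : h != 0 by apply/eqP => h0; apply: nh => i; rewrite h0 coef0; apply: (ideal0 ip).
pose g := h - (lead_coef h)%:P * 'X^((size h).-1).
have sg : (size g < size h)%N.
  rewrite -(prednK (_ : 0 < size h)%N) ?size_poly_gt0 // ltnS.
  apply/leq_sizeP => j; rewrite leq_eqVlt => /predU1P[<-|hj].
    by rewrite coefB coefCM coefXn eqxx mulr1 subrr.
  by rewrite coefB coefCM coefXn gtn_eqF // mulr0 subr0 nth_default ?(leq_trans (leqSpred _) hj).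
have [|||f Qf [nf sf]] := IH g.
- by rewrite (leq_trans sg).
- by apply: (idealB iQ) => //; apply: pQ.
- move=> eg; apply: nh; rewrite -[h](subrK ((lead_coef h)%:P * 'X^((size h).-1))).
  by apply: (idealD (extend_ideal ip)).
by exists f => //; split=> //; apply: leq_trans sf (ltnW sg).
Qed.

(** h has least degree among the elements of Q with leading coefficient outside p. Pseudo-division
    by h leaves a remainder of smaller degree in Q, which [lead_out] forces into the extension. *)
Lemma min_generator p Q : is_ideal p -> is_ideal Q -> extend p `<=` Q -> ~ Q `<=` extend p ->
  exists h, [/\ Q h, ~ p (lead_coef h) &
    forall w, Q w -> exists e q r, extend p r /\ lead_coef h ^+ e *: w = q * h + r].
Proof.
move=> ip iQ pQ /existsNP[h0 /not_implyP[Qh0 nh0]].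
pose A k := `[< exists2 h, Q h & ~ p (lead_coef h) /\ size h = k >].
have ex : exists k, A k.
  by have [g Qg [ng _]] := lead_out ip iQ pQ Qh0 nh0; exists (size g); apply/asboolP; exists g.
have [k /asboolP[h Qh [nh sh]] mink] := ex_minnP ex.
have hn0 : h != 0 by apply/eqP => h00; apply: nh; rewrite h00 lead_coef0; apply: (ideal0 ip).
exists h; split=> // w Qw; exists (Pdiv.Ring.rscalp w h), (Pdiv.Ring.rdivp w h), (Pdiv.Ring.rmodp w h).
have E := Pdiv.ComRing.rdivp_eq h w; split=> //.
apply: contrapT => nr; have Qr : Q (Pdiv.Ring.rmodp w h).
  have -> : Pdiv.Ring.rmodp w h =
      (lead_coef h ^+ Pdiv.Ring.rscalp w h) *: w - Pdiv.Ring.rdivp w h * h.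
    by rewrite E addrC addKr.
  by apply: (idealB iQ); rewrite -?mul_polyC; apply: (idealMl _ iQ).
have [g Qg [ng sg]] := lead_out ip iQ pQ Qr nr.
have : A (size g) by apply/asboolP; exists g.
by move/mink; rewrite -sh leqNgt (leq_ltn_trans sg) ?Pdiv.CommonRing.ltn_rmodpN0.
Qed.

Lemma extend_loc s P : is_prime P -> contract P `<=` loc (ideal_of s) (contract P) ->
  extend (contract P) `<=` loc (ideal_of (map polyC s)) P.
Proof.
move=> pP sP h hP; have iS := ideal_of_ideal (map polyC s).
have iL := loc_ideal pP iS; rewrite [h]poly_sum_coef; apply: (ideal_sum _ iL) => i _.
apply: (idealMr _ iL); have [t [nt It]] := sP _ (hP i); exists t%:P; split=> //.
rewrite -polyCM.
have := ideal_of_min (preimage_ideal (polyC : {rmorphism R -> {poly R}}) iS); apply; last exact: It.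
by move=> y ys; apply: mem_ideal_of; apply: map_f.
Qed.

(* Localized at the contracted prime, a prime not extended from the base is
   generated over the extension by one element of least degree. *)
Lemma locgen_step s P : is_prime P -> contract P `<=` loc (ideal_of s) (contract P) ->
  {in s, forall c, contract P c} -> ~ P `<=` extend (contract P) ->
  exists h, [/\ P h & P `<=` loc (ideal_of (h :: map polyC s)) P].
Proof.
move=> pP sP Ps nP; have pp := contract_prime pP; have iP := prime_ideal pP.
have [h [Ph nh hP]] := min_generator (prime_ideal pp) iP (extend_contract iP) nP.
exists h; split=> // w Pw; have [e [q [r [er E]]]] := hP _ Pw.
have iJ := ideal_of_ideal (h :: map polyC s); have iL := loc_ideal pP iJ.
apply: (@locM _ _ _ (lead_coef h ^+ e)%:P) => //; first exact: (primeNX pp).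
rewrite mul_polyC E; apply: (idealD iL).
  by apply: (idealMl _ iL); apply: (sub_loc pP); apply: mem_ideal_of; rewrite mem_head.
have [t [nt It]] := extend_loc pP sP er; exists t; split=> //.
by apply: ideal_of_min It => // y ys; apply: mem_ideal_of; rewrite inE ys orbT.
Qed.

End PolyExtension.

Lemma ideal_of_map (A B : comNzRingType) (u : {rmorphism A -> B}) (s : seq A) x :
  ideal_of s x -> ideal_of (map u s) (u x).
Proof.
have iS := ideal_of_ideal (map u s).
apply: (ideal_of_min (preimage_ideal u iS)) => y ys.
by apply: mem_ideal_of; apply: map_f.
Qed.

(* The images of the variables under beta are r elements algebraically
   independent modulo P. *)
Definition indep (K : comNzRingType) m r (P : set {mpoly K[m]}) :=
  exists beta : {rmorphism {mpoly K[r]} -> {mpoly K[m]}},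
    (forall c, beta c%:MP = c%:MP) /\ forall F, P (beta F) -> F = 0.

Lemma mpoly0_prime (K : fieldType) (P : set {mpoly K[0]}) x : is_prime P -> P x -> x = 0.
Proof.
move=> pP; rewrite [x]nvar0_mpolyC => Px; have [->|x0] := eqVneq (x@_0) 0.
  by rewrite mpolyC0.
exfalso; apply: (prime1 pP); rewrite -mpolyC1 -(mulVf x0) mpolyCM.
by apply: (idealMl _ (prime_ideal pP)).
Qed.

(* Adjoining the variables one at a time, each step either extends the prime
   below it, which adds a transcendental, or lengthens the chain by one and
   adds one local generator. *)
Lemma prime_tower (K : fieldType) m (P : set {mpoly K[m]}) : is_prime P ->
  exists k r s, [/\ (k + r = m)%N, prime_chain [set 0] P k,
    size s = k /\ {in s, forall x, P x}, P `<=` loc (ideal_of s) P & indep r P].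
Proof.
elim: m P => [|m IH] P pP.
  have iP := prime_ideal pP; exists 0%N, 0%N, [::]; split=> //.
  - by apply/prime_chain0; split=> // _ ->; apply: (ideal0 iP).
  - move=> x /(mpoly0_prime pP) ->; apply: (ideal0 (loc_ideal pP _)).
    exact: ideal_of_ideal.
  - by exists idfun; split=> // F /(mpoly0_prime pP).
pose u := to_poly (fun=> 0 : K) : {rmorphism {mpoly K[m.+1]} -> _}.
pose v := of_poly (fun=> 0 : K) : {rmorphism _ -> {mpoly K[m.+1]}}.
have uK : cancel u v by exact: to_polyK.
have vK : cancel v u by exact: of_polyK.
pose Q := v @^-1` P; have pQ : is_prime Q by exact: preimage_prime.
have PQ : u @^-1` Q = P by apply/funext => x; congr P; exact: uK.
have PvQ x : Q x -> P (v x) by [].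
have su y : exists x, u x = y by exists (v y).
have [k [r [s [krm ck [sk sp] lp [beta [betaC betaP]]]]]] := IH _ (contract_prime pQ).
have locP s' : Q `<=` loc (ideal_of s') Q -> P `<=` loc (ideal_of (map v s')) P.
  move=> sQ x; rewrite -{1}PQ => /sQ[t [nt It]]; exists (v t); split=> //.
  by rewrite -[x]uK -rmorphM; apply: ideal_of_map.
have iQ := prime_ideal pQ.
have vC c : v c%:MP%:P = c%:MP by rewrite [v _]of_polyC of_coefC.
have uC c : to_poly (fun=> 0 : K) c%:MP = c%:MP%:P :> {poly {mpoly K[r]}} by rewrite to_polyC.
have [sQ|nQ] := pselect (Q `<=` extend (contract Q)).
  have QE : extend (contract Q) = Q.
    by apply/seteqP; split=> //; apply: extend_contract.
  exists k, r.+1, (map v (map polyC s)); split.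
  - by rewrite addnS krm.
  - by rewrite -PQ; apply: preimage_chain => //; rewrite -QE; apply: extend_chain.
  - by rewrite !size_map; split=> // _ /mapP[_ /mapP[y /sp ys ->] ->].
  - by apply: locP; rewrite -{1}QE; apply: extend_loc.
  - exists (v \o map_poly beta \o to_poly (fun=> 0 : K)); split=> [c|F].
      by rewrite /= -[mmap _ _ _]/(to_poly _ _) uC map_polyC /= betaC -[RHS]vC.
    move=> PF; have {}PF : Q (map_poly beta (to_poly (fun=> 0 : K) F)) by [].
    apply: (can_inj (to_polyK (fun=> 0 : K))); rewrite rmorph0; apply/polyP => i.
    by rewrite coef0; apply: betaP; rewrite -coef_map; apply: sQ.
have [h [Qh hQ]] := locgen_step pQ lp sp nQ.
exists k.+1, r, (map v (h :: map polyC s)); split.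
- by rewrite addSn krm.
- rewrite -PQ; apply: preimage_chain => //; apply/prime_chainS; exists (extend (contract Q)).
  by split=> //; [exact: extend_chain | split=> //; apply: extend_contract].
- rewrite /= !size_map sk; split=> // x.
  by rewrite inE => /predU1P[->|/mapP[_ /mapP[z /sp zs ->] ->]].
- exact: locP.
- exists (v \o polyC \o beta); split=> [c|F PF]; last exact: betaP.
  by rewrite /= betaC -[RHS]vC.
Qed.

(* A K-point of the base at which b0 does not vanish lifts to a zero of P at
   which b does not vanish. For b0 one takes an element of (P + (b)) lying in R,
   times the leading coefficient of a generic generator of P. *)
Lemma extend_zero (R : comNzRingType) (K : closedFieldType) (P : set {poly R}) b :
  is_prime P -> ~ P b -> exists b0 : R, ~ contract P b0 /\
  forall chi : {rmorphism R -> K}, (forall c, contract P c -> chi c = 0) -> chi b0 != 0 ->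
  exists xi, (forall h, P h -> (map_poly chi h).[xi] = 0) /\ (map_poly chi b).[xi] != 0.
Proof.
move=> pP nb; have iP := prime_ideal pP; have pp := contract_prime pP.
have ip := prime_ideal pp; have eP := extend_contract iP.
have [sP|nP] := pselect (P `<=` extend (contract P)).
  have /existsNP[i ni] : ~ extend (contract P) b by move/eP.
  exists b`_i; split=> // chi chiP chib.
  have b0 : map_poly chi b != 0.
    by apply: contra_neq chib => b0; rewrite -coef_map b0 coef0.
  have [xi xib] := closed_nonrootP _ b0; exists xi; split=> // h /sP hP.
  suff -> : map_poly chi h = 0 by rewrite horner0.
  by apply/polyP => j; rewrite coef_map coef0; apply: chiP.
have [h1 [Ph1 n1 gen1]] := min_generator ip iP eP nP.
pose J : set {poly R} := [set w | exists2 x, P x & exists y, w = x + y * b].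
have PJ : P `<=` J by move=> x Px; exists x => //; exists 0; rewrite mul0r addr0.
have Jb : J b by exists 0; [exact: (ideal0 iP) | exists 1; rewrite mul1r add0r].
have iJ : is_ideal J.
  split=> [|_ _ [x Px [y ->]] [x' Px' [y' ->]]|r _ [x Px [y ->]]].
  - by apply: PJ; apply: (ideal0 iP).
  - by exists (x + x'); [apply: (idealD iP) | exists (y + y'); rewrite mulrDl addrACA].
  - by exists (r * x); [apply: (idealMl _ iP) | exists (r * y); rewrite mulrDr mulrA].
have [h2 [Jh2 n2 gen2]] := min_generator ip iJ (subset_trans eP PJ) (fun s => nP (subset_trans PJ s)).
have [e2 [q2 [r2 [er2 E2]]]] := gen2 _ Jb.
have [e1 [q1 [r1 [er1 E1]]]] := gen2 _ (PJ _ Ph1).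
(* [q1 * h2] lies in P and h2 does not: otherwise a power of its leading coefficient times b, hence
   b itself, would lie in P. *)
have Pq1 : P q1.
  have : P (q1 * h2).
    apply: (ideal_addr iP (eP _ er1)); rewrite -E1 -mul_polyC.
    exact: (idealMl _ iP).
  case/(primeM pP) => // Ph2; exfalso; apply: nb.
  have : P ((lead_coef h2 ^+ e2)%:P * b).
    rewrite mul_polyC E2; apply: (idealD iP); last exact: eP.
    exact: (idealMl _ iP).
  by case/(primeM pP) => // /(primeX pp).
have [e3 [q3 [r3 [er3 E3]]]] := gen1 _ Pq1.
pose c := lead_coef h1 ^+ e3 * lead_coef h2 ^+ e1.
have nc : ~ contract P c by apply: (primeNM pp); apply: (primeNX pp).
(* Substituting the division of q1 by h1 into that of h1 by h2 puts [h1 * (c%:P - q3 * h2)] in the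
   prime [extend (contract P)]. As h1 is not in it, c agrees with [q3 * h2] modulo P. *)
have Jc : J c%:P.
  have : extend (contract P) (h1 * (c%:P - q3 * h2)).
    have -> : h1 * (c%:P - q3 * h2) = (lead_coef h1 ^+ e3)%:P * r1 + r3 * h2.
      have -> : r1 = (lead_coef h2 ^+ e1)%:P * h1 - q1 * h2 by rewrite mul_polyC E1 addrC addKr.
      have -> : r3 = (lead_coef h1 ^+ e3)%:P * q1 - q3 * h1 by rewrite mul_polyC E3 addrC addKr.
      rewrite /c polyCM; ring.
    have iE := extend_ideal ip.
    by apply: (idealD iE); [apply: (idealMl _ iE) | apply: (idealMr _ iE)].
  case/(primeM (extend_prime pp)) => [eh1|/eP Pd]; first by case: (n1 (eh1 _)).
  rewrite -[c%:P](subrK (q3 * h2)); apply: (idealD iJ); first exact: PJ.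
  exact: (idealMl _ iJ).
have {Jc}[x Px [y Ec]] := Jc.
(* The factor [lead_coef h1] preserves the degree of h1 under chi, so that a root exists; the factor
   c keeps b from vanishing there. *)
exists (lead_coef h1 * c); split; first exact: (primeNM pp).
move=> chi chiP; rewrite rmorphM mulf_eq0 => /norP[chi1 chic].
have sh1 : size (map_poly chi h1) != 1%N.
  rewrite size_map_poly_id0 //; apply/eqP => /eqP/size_poly1P[d d0 h1d].
  by apply: n1; rewrite h1d lead_coefC /contract /preimage /= -h1d.
have [xi /rootP xi1] := closed_rootP _ sh1.
have zero h : P h -> (map_poly chi h).[xi] = 0.
  move=> Ph; have [e [q [r [er E]]]] := gen1 _ Ph.
  have := congr1 (fun w => (map_poly chi w).[xi]) E.
  rewrite /= -mul_polyC rmorphD !rmorphM /= !hornerE xi1 mulr0 add0r map_polyC hornerC.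
  have -> : map_poly chi r = 0.
    by apply/polyP => j; rewrite coef_map coef0; apply: chiP.
  have chie : chi (lead_coef h1 ^+ e) != 0 by rewrite (rmorphXn chi) expf_neq0.
  by rewrite horner0 => /eqP; rewrite mulf_eq0 (negPf chie) => /eqP.
exists xi; split=> //; apply: contra_neq chic => b0.
have := congr1 (fun w => (map_poly chi w).[xi]) Ec.
by rewrite /= map_polyC hornerC rmorphD rmorphM !hornerE b0 zero // mulr0 addr0.
Qed.

(** A point is kept as a ring morphism to K, the form in which [extend_zero] prolongs it by one
    variable at a time. *)
Lemma nullstellensatz_rmorph (K : closedFieldType) m (P : set {mpoly K[m]}) b :
  is_prime P -> ~ P b -> exists chi : {rmorphism {mpoly K[m]} -> K},
  [/\ forall c, chi c%:MP = c, forall h, P h -> chi h = 0 & chi b != 0].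
Proof.
elim: m P b => [|m IH] P b pP nb.
  exists (meval (fun=> 0)); split=> [c|h /(mpoly0_prime pP) ->|].
  - exact: mevalC.
  - exact: rmorph0.
  - rewrite -[X in X != 0]/(b.@[fun=> 0]); apply: contra_notN nb.
    rewrite {1}[b]nvar0_mpolyC mevalC => /eqP b0.
    by rewrite [b]nvar0_mpolyC b0 mpolyC0; apply: (ideal0 (prime_ideal pP)).
pose u := to_poly (fun=> 0 : K) : {rmorphism {mpoly K[m.+1]} -> _}.
pose v := of_poly (fun=> 0 : K) : {rmorphism _ -> {mpoly K[m.+1]}}.
have uK : cancel u v by exact: to_polyK.
pose Q := v @^-1` P; have pQ : is_prime Q by exact: preimage_prime.
have Qu x : Q (u x) = P x by congr P; exact: uK.
have nub : ~ Q (u b) by rewrite Qu.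
have [b0 [nb0 ext]] := @extend_zero _ K _ _ pQ nub.
have [chi [chiC chi0 chib]] := IH _ _ (contract_prime pQ) nb0.
have [xi [xi0 xib]] := ext chi chi0 chib.
exists (horner_eval xi \o map_poly chi \o u); split=> [c|h Ph|//].
  by rewrite -[LHS]/((map_poly chi (u c%:MP)).[xi]) [u _]to_polyC map_polyC hornerC; apply: chiC.
by rewrite -[LHS]/((map_poly chi (u h)).[xi]); apply: xi0; rewrite Qu.
Qed.

Lemma nullstellensatz (K : closedFieldType) m (P : set {mpoly K[m]}) b :
  is_prime P -> ~ P b -> exists a : 'I_m -> K, (forall h, P h -> h.@[a] = 0) /\ b.@[a] != 0.
Proof.
move=> pP nb; have [chi [chiC chi0 chib]] := nullstellensatz_rmorph pP nb.
have E : chi =1 meval (fun i => chi 'X_i).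
  apply: mpoly_rmorph_ext => [c|i]; first by rewrite chiC [RHS]mevalC.
  by rewrite [RHS]mevalXU.
by exists (fun i => chi 'X_i); split=> [h Ph|]; rewrite -[meval _ _]E //; apply: chi0.
Qed.

(** * Dimension of polynomial rings *)

(** The new element is some y in P outside P'. The constant coefficient of a relation in y modulo P'
    lies in P, so it vanishes; then y cancels modulo P' and the degree drops. *)
Lemma indep_step (K : comNzRingType) m r (P P' : set {mpoly K[m]}) :
  is_prime P' -> is_prime P -> P' `<` P -> indep r P -> indep r.+1 P'.
Proof.
move=> pP' pP [sP /existsNP[y /not_implyP[Py nPy]]] [beta [betaC betaP]].
exists (horner_eval y \o map_poly beta \o to_poly (fun=> 0 : K)); split=> [c|F].
  rewrite -[LHS]/((map_poly beta (to_poly (fun=> 0 : K) c%:MP)).[y]).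
  by rewrite [to_poly _ _]to_polyC map_polyC hornerC; apply: betaC.
move=> P'F; apply: (can_inj (to_polyK (fun=> 0 : K))); rewrite rmorph0.
have {P'F} : P' (map_poly beta (to_poly (fun=> 0 : K) F)).[y] by [].
elim/poly_ind: (to_poly _ F) => // G c IH.
rewrite rmorphD rmorphM /= map_polyX map_polyC !hornerE => P'G.
have {}P'G : P' ((map_poly beta G).[y] * y + beta c) by [].
have iP := prime_ideal pP.
have c0 : c = 0.
  apply: betaP; have := sP _ P'G; rewrite addrC; apply: (ideal_addr iP).
  exact: (idealMl _ iP).
have b0 : beta c = 0 by rewrite c0 rmorph0.
move: P'G; rewrite b0 addr0 c0 => /(primeM pP')[/IH ->|//].
by rewrite mul0r polyC0 addr0.
Qed.

Lemma dependent_combination (K : fieldType) m (P : set {mpoly K[m]}) (I J : finType)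
    (u : I -> {mpoly K[m]}) (w : J -> {mpoly K[m]}) :
  is_ideal P -> (#|J| < #|I|)%N ->
  (forall i, exists c : J -> K, P (u i - \sum_j c j *: w j)) ->
  exists v : I -> K, (exists i, v i != 0) /\ P (\sum_i v i *: u i).
Proof.
move=> iP JI /choice[c cP].
pose A := \matrix_(i < #|I|, j < #|J|) c (enum_val i) (enum_val j).
have : kermx A != 0.
  rewrite kermx_eq0 -row_leq_rank -ltnNge; exact: leq_ltn_trans (rank_leq_col _) JI.
move=> /rowV0Pn[v /sub_kermxP vA v0].
exists (fun i => v 0 (enum_rank i)); split.
  have [j vj] : exists j, v 0 j != 0.
    apply: contrapT => nv; move/negP: v0; apply; apply/eqP/rowP => j; rewrite mxE.
    by apply/eqP; apply: contrapT => /negP vj; apply: nv; exists j.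
  by exists (enum_val j); rewrite enum_valK.
have -> : \sum_i v 0 (enum_rank i) *: u i =
    \sum_i v 0 (enum_rank i) *: (u i - \sum_j c i j *: w j).
  under [RHS]eq_bigr => i _ do rewrite scalerBr scaler_sumr.
  rewrite sumrB [X in _ - X]exchange_big /= [X in _ - X]big1 ?subr0 // => j _.
  under eq_bigr => i _ do rewrite scalerA.
  rewrite -scaler_suml; have /rowP/(_ (enum_rank j)) := vA.
  rewrite !mxE => E; rewrite -[RHS](scale0r (w j)); congr (_ *: _); rewrite -[RHS]E.
  rewrite (reindex (@enum_val _ I)) /=; last exact/onW_bij/enum_val_bij.
  by apply: eq_bigr => i _; rewrite !mxE enum_valK enum_rankK.
apply: (ideal_sum _ iP) => i _; rewrite -mul_mpolyC; exact: (idealMl _ iP).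
Qed.

(* The Hilbert function of S / P grows at most like a polynomial of degree N. *)
Definition growth_le (K : comNzRingType) m (P : set {mpoly K[m]}) N :=
  exists C, forall d, exists (J : finType) (w : J -> {mpoly K[m]}),
    (#|J| <= C * d.+1 ^ N)%N /\
    forall h, (msize h <= d)%N -> exists c : J -> K, P (h - \sum_j c j *: w j).

Lemma msizeM_leS (K : idomainType) m (p q : {mpoly K[m]}) a b :
  (msize p <= a.+1)%N -> (msize q <= b.+1)%N -> (msize (p * q) <= (a + b).+1)%N.
Proof.
have [->|p0] := eqVneq p 0; first by rewrite mul0r msize0.
have [->|q0] := eqVneq q 0; first by rewrite mulr0 msize0.
by rewrite msizeM // => pa qb; lia.
Qed.

Lemma msizeX_leS (K : idomainType) m (p : {mpoly K[m]}) a k :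
  (msize p <= a.+1)%N -> (msize (p ^+ k) <= (a * k).+1)%N.
Proof.
move=> pa; elim: k => [|k IH]; first by rewrite expr0 msize1 muln0.
by rewrite exprS mulnS; apply: msizeM_leS.
Qed.

Lemma msize_prod_leS (K : idomainType) m (I : Type) (r : seq I) (F : I -> {mpoly K[m]}) (a : I -> nat) :
  (forall i, (msize (F i) <= (a i).+1)%N) ->
  (msize (\prod_(i <- r) F i) <= (\sum_(i <- r) a i).+1)%N.
Proof.
move=> Fa; elim/big_rec2: _ => [|i x y _ IH]; first by rewrite msize1.
exact: msizeM_leS.
Qed.

(* The D^r monomials in r independent elements with exponents below D have
   degree O(D), so they cannot be independent modulo P if N < r and D is large. *)
Lemma indep_growth (K : fieldType) m (P : set {mpoly K[m]}) N r :
  is_ideal P -> growth_le P N -> indep r P -> (r <= N)%N.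
Proof.
move=> iP [C gC] [beta [betaC betaP]]; rewrite leqNgt; apply/negP => Nr.
pose e := (\max_(i < r) msize (beta 'X_i))%N.
have eP i : (msize (beta 'X_i) <= e.+1)%N.
  by apply: leqW; apply: (leq_bigmax (F := fun i => msize (beta 'X_i)) i).
(* The monomials used have [msize] at most e D r + 1, and e D r + 2 <= (e r + 3) D. The growth bound
   is thus C (e r + 3)^N D^N, which is below D^(N+1) because D exceeds C (e r + 3)^N. *)
pose D := (C * (e * r + 3) ^ N).+1.
pose I := {ffun 'I_r -> 'I_D}.
pose mon (f : I) := [multinom (f i : nat) | i < r].
have szm f : (msize (beta 'X_[mon f]) <= (e * D * r).+1)%N.
  rewrite mpolyXE_id rmorph_prod; apply: (@leq_trans (\sum_(i < r) e * D).+1%N).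
    apply: msize_prod_leS => i; rewrite rmorphXn; apply: leq_trans (msizeX_leS _ (eP i)) _.
    by rewrite ltnS leq_mul2l mnmE ltnW ?orbT.
  by rewrite sum_nat_const card_ord mulnC.
have [J [w [Jle Jw]]] := gC (e * D * r).+1.
have JI : (#|J| < #|I|)%N.
  apply: leq_ltn_trans Jle _; rewrite card_ffun !card_ord.
  apply: (@leq_trans (D ^ N.+1)); last by rewrite leq_pexp2l.
  apply: (@leq_ltn_trans (C * (e * r + 3) ^ N * D ^ N)).
    rewrite -[X in (_ <= X)%N]mulnA -expnMn leq_mul2l; apply/orP; right.
    by case: (N) => // N'; rewrite leq_exp2r //; have : (0 < D)%N by []; nia.
  by rewrite expnS ltn_pmul2r ?expn_gt0.
have [v [[f vf] Pv]] := dependent_combination iP JI (fun f => Jw _ (szm f)).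
have betaZ a F : beta (a *: F) = a *: beta F by rewrite -!mul_mpolyC rmorphM betaC.
have monI : injective mon.
  move=> f1 f2 /mnmP E; apply/ffunP => i; apply/val_inj; have := E i.
  by rewrite !mnmE.
have : \sum_f v f *: 'X_[mon f] = 0.
  apply: betaP; rewrite raddf_sum; move: Pv.
  by congr P; apply: eq_bigr => g _; apply/esym/betaZ.
move/(congr1 (mcoeff (mon f))); rewrite mcoeff0 raddf_sum (bigD1 f) //= big1 => [|g gf].
  by rewrite mcoeffZ mcoeffX eqxx mulr1 addr0 => /eqP; rewrite (negPf vf).
by rewrite mcoeffZ mcoeffX (inj_eq monI) (negPf gf) mulr0.
Qed.

Lemma growth_zero (K : fieldType) m : growth_le [set (0 : {mpoly K[m]})] m.
Proof.
exists 1%N => d; exists 'X_{1..m < d}, (fun b : 'X_{1..m < d} => 'X_[b] : {mpoly K[m]}); split=> [|h hd].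
  have lt (b : 'X_{1..m < d}) (i : 'I_m) : (b i < d.+1)%N.
    by rewrite ltnS (leq_trans _ (ltnW (bmdeg b))) // mdegE (bigD1 i) //= leq_addr.
  pose F (b : 'X_{1..m < d}) : {ffun 'I_m -> 'I_d.+1} := [ffun i => Ordinal (lt b i)].
  rewrite mul1n -[X in (_ <= X ^ _)%N]card_ord -[X in (_ <= _ ^ X)%N]card_ord -card_ffun.
  apply: (@leq_card _ _ F) => b c /ffunP E; apply/val_inj/mnmP => i.
  by have := E i; rewrite !ffunE => /(congr1 val).
exists (fun b : 'X_{1..m < d} => h@_b); rewrite -mpolywE //; exact: subrr.
Qed.

(* Choosing y in P outside P' turns r elements independent modulo P into r + 1
   elements independent modulo P'. *)
Lemma chain_indep_le (K : fieldType) m (P : set {mpoly K[m]}) k r :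
  prime_chain [set 0] P k -> indep r P -> (k + r <= m)%N.
Proof.
elim: k r P => [|k IH] r P.
  move=> /prime_chain0[pP P0] [beta [betaC betaP]]; rewrite add0n.
  apply: (indep_growth (zero_ideal _) (growth_zero K m)).
  by exists beta; split=> // F F0; apply: betaP; apply: P0.
case/prime_chainS=> P' [cP' pP sP] iP; rewrite addSnnS; apply: IH (cP') _.
exact: indep_step (prime_chain_prime cP') pP sP iP.
Qed.

(** * Unmixedness of complete intersections *)

Lemma zero_prime (R : idomainType) : is_prime [set (0 : R)].
Proof.
split; [exact: zero_ideal | exact/eqP/oner_neq0 | move=> a b /= /eqP].
by rewrite mulf_eq0 => /orP[]/eqP; [left | right].
Qed.

Lemma meval_dhomog (K : comNzRingType) m (p : {mpoly K[m]}) d (v : 'I_m -> K) c :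
  p \is d.-homog -> p.@[fun i => c * v i] = c ^+ d * p.@[v].
Proof.
move=> /dhomogP hp; rewrite !mevalE mulr_sumr; apply: eq_big_seq => mm /hp /= <-.
rewrite mdegE -prodrXr mulrCA; congr (_ * _); rewrite -big_split /=.
by apply: eq_bigr => i _; rewrite exprMn.
Qed.

(** Here d only bounds the degree and c may vanish, so the notion is multiplicative over any
    ring. *)
Definition top_coef (B : nzRingType) d (c : B) (p : {poly B}) :=
  (size p <= d.+1)%N /\ p`_d = c.

Lemma top_coefM (B : nzRingType) d e (c b : B) p q :
  top_coef d c p -> top_coef e b q -> top_coef (d + e)%N (c * b) (p * q).
Proof.
move=> [sp pc] [sq qb]; split.
  by apply: leq_trans (size_polyMleq _ _) _; lia.
have dd : (d < (d + e).+1)%N by lia.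
rewrite coefM (bigD1 (Ordinal dd)) //= addKn pc qb big1 ?addr0 // => i.
rewrite -val_eqE /= => id; have [lt|lt] := ltnP d i.
  by rewrite [p`_i]nth_default ?mul0r // (leq_trans sp).
rewrite [q`__]nth_default ?mulr0 // (leq_trans sq) //; lia.
Qed.

Lemma top_coefX (B : nzRingType) d (c : B) p k :
  top_coef d c p -> top_coef (d * k)%N (c ^+ k) (p ^+ k).
Proof.
move=> pc; elim: k => [|k IH].
  by rewrite muln0 !expr0; split; rewrite ?size_poly1 ?coef1.
by rewrite mulnS !exprS; apply: top_coefM.
Qed.

Lemma top_coef_prod (B : nzRingType) (I : Type) (r : seq I) (d : I -> nat) (c : I -> B) p :
  (forall i, top_coef (d i) (c i) (p i)) ->
  top_coef (\sum_(i <- r) d i)%N (\prod_(i <- r) c i) (\prod_(i <- r) p i).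
Proof.
move=> pc; elim/big_rec3: _ => [|i x y z _ IH]; last exact: top_coefM.
by split; rewrite ?size_poly1 ?coef1.
Qed.

(** The variable [X_i] has degree at most one in the new X, with coefficient [v i]. A monomial thus
    contributes its value at v in its own degree, and only those of degree d reach X^d. *)
Lemma to_poly_top (K : comNzRingType) m (a : 'I_m -> K) (h : {mpoly K[m.+1]}) d :
  (msize h <= d.+1)%N -> top_coef d
    ((pihomog mdeg d h).@[fun i => if unlift ord_max i is Some j then a j else 1])%:MP
    (to_poly a h).
Proof.
set v := fun i => _; move=> hd.
have topX i : top_coef 1 (v i)%:MP (to_poly a 'X_i).
  rewrite to_polyX /shear_var /v; case: unlift => [j|]; last first.
    by split; rewrite ?size_polyX ?coefX ?mpolyC1.
  split; last by rewrite coefD coefC coefCM coefX /= add0r mulr1.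
  apply: leq_trans (size_polyD _ _) _; rewrite geq_max (leq_trans (size_polyC_leq1 _)) //=.
  by apply: leq_trans (size_polyMleq _ _) _; rewrite size_polyX addn2 /= ltnS size_polyC_leq1.
have topM mm : top_coef (mdeg mm) (\prod_i v i ^+ mm i)%:MP (to_poly a 'X_[mm]).
  rewrite mpolyXE_id !rmorph_prod mdegE.
  under [X in top_coef _ X _]eq_bigr do rewrite rmorphXn.
  under [X in top_coef _ _ X]eq_bigr do rewrite rmorphXn.
  by apply: top_coef_prod => i; have := top_coefX (mm i) (topX i); rewrite mul1n.
have E : to_poly a h = \sum_(mm <- msupp h) (h@_mm)%:MP *: to_poly a 'X_[mm].
  rewrite {1}[h]mpolyE raddf_sum; apply: eq_bigr => mm _ /=.
  by rewrite -mul_mpolyC -mul_polyC -[mmap _ _ (_ * _)]/(to_poly a _) rmorphM to_polyC.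
split.
  rewrite E; apply: leq_trans (size_sum _ _ _) _; apply/bigmax_leqP_seq => mm mh _.
  apply: leq_trans (size_scale_leq _ _) _; apply: leq_trans (topM mm).1 _.
  exact: leq_trans (msize_mdeg_lt mh) hd.
have -> : (pihomog mdeg d h).@[v] =
    \sum_(mm <- msupp h | mdeg mm == d) h@_mm * \prod_i v i ^+ mm i.
  rewrite pihomogE (raddf_sum (meval v)) /=; apply: eq_bigr => mm _.
  by rewrite [LHS]mevalZ mevalX.
rewrite E coef_sum (raddf_sum (@mpolyC m K)) [RHS]big_mkcond /=; apply: eq_big_seq => mm mh.
rewrite coefZ; case: eqP => [dE|dN]; first by rewrite -dE (topM mm).2 -mpolyCM.
rewrite nth_default ?mulr0 //; apply: leq_trans (topM mm).1 _.
rewrite ltn_neqAle; apply/andP; split; first exact/eqP.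
by rewrite -ltnS (leq_trans (msize_mdeg_lt mh)).
Qed.

Lemma monic_shear (K : closedFieldType) m (h : {mpoly K[m.+1]}) : h != 0 ->
  exists a : 'I_m -> K, lead_coef (to_poly a h) \in GRing.unit.
Proof.
move=> h0; pose d := (msize h).-1.
have sh : (msize h <= d.+1)%N by rewrite /d; case: (msize h).
pose G := pihomog mdeg d h.
have G0 : G != 0.
  apply/eqP => /(congr1 (mcoeff (mlead h))); rewrite mcoeff0 /G pihomogE raddf_sum /=.
  have md : mdeg (mlead h) = d by rewrite /d -(mlead_deg h0).
  rewrite big_mkcond (bigD1_seq (mlead h)) ?msupp_uniq ?mlead_supp //= md eqxx.
  rewrite big1 => [|mm ne].
    rewrite mcoeffZ mcoeffX eqxx mulr1 addr0 => /eqP.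
    by rewrite mleadc_eq0 (negPf h0).
  by case: ifP => // _; rewrite mcoeffZ mcoeffX (negPf ne) mulr0.
(* The factor ['X_ord_max] yields a point with nonzero last coordinate, which can be rescaled to the
   form (a, 1). *)
have nz : ~ [set (0 : {mpoly K[m.+1]})] (G * 'X_ord_max).
  move/eqP; rewrite mulf_eq0 (negPf G0) => /eqP /(congr1 (mcoeff U_(ord_max)))/eqP.
  by rewrite mcoeffX mcoeff0 eqxx oner_eq0.
have [w [_ ]] := nullstellensatz (@zero_prime _) nz.
rewrite mevalM mevalXU mulf_eq0 => /norP[Gw w0].
pose a j := (w ord_max)^-1 * w (lift ord_max j); exists a.
have [sz co] := to_poly_top a sh; set v := (fun i => _) in co.
have Ev : G.@[w] = (w ord_max) ^+ d * G.@[v].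
  rewrite -meval_dhomog ?pihomogP //; apply: meval_eq => i; rewrite /v.
  by case: unliftP => [j ->|->]; rewrite ?mulr1 // /a mulVKf.
have Gv : G.@[v] != 0 by apply: contra_neq Gw => Gv; rewrite Ev Gv mulr0.
have -> : lead_coef (to_poly a h) = (G.@[v])%:MP.
  rewrite -co lead_coefE; congr (_ _ _ _).
  suff -> : size (to_poly a h) = d.+1 by [].
  apply/eqP; rewrite eqn_leq sz /=; rewrite ltnNge; apply: contra_neqN Gv => sz'.
  by move/eqP: co; rewrite nth_default // eq_sym mpolyC_eq0 => /eqP.
by apply: rmorph_unit; rewrite unitfE.
Qed.

(** c times the remainder of p by F is a multiple of F of smaller degree, hence zero. *)
Lemma unit_lead_torsion (B : idomainType) (F p q : {poly B}) c :
  lead_coef F \in GRing.unit -> c != 0 -> c%:P * p = q * F -> exists z, p = z * F.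
Proof.
move=> uF c0 E; exists (p %/ F)%R; rewrite {1}(Pdiv.IdomainUnit.divp_eq uF p).
have F0 : F != 0 by apply: contraTneq uF => ->; rewrite lead_coef0 unitr0.
have [-> | r0] := eqVneq (p %% F) 0; first by rewrite addr0.
have E2 : c%:P * (p %% F) = (q - c%:P * (p %/ F)) * F.
  have -> : p %% F = p - p %/ F * F by rewrite {2}(Pdiv.IdomainUnit.divp_eq uF p) addrC addKr.
  by rewrite mulrBr E mulrBl mulrA.
have := ltn_modpN0 p F0; rewrite -(size_Cmul (p %% F) c0) E2.
have [w0|w0] := eqVneq (q - c%:P * (p %/ F)) 0.
  by move/eqP: E2; rewrite w0 mul0r mulf_eq0 polyC_eq0 (negPf c0) (negPf r0).
by rewrite size_mul // ltnNge; move: (size_poly_gt0 (q - c%:P * (p %/ F))); rewrite w0; lia.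
Qed.

(** Replace p and q by their remainders modulo F: the difference of the two sides is a multiple of F
    of smaller degree, hence zero. The torsion hypothesis then divides each coefficient of the
    remainder of p by r. *)
Lemma unit_lead_torsion2 (B : idomainType) (F p q y : {poly B}) b r :
  lead_coef F \in GRing.unit -> (forall c c', b * c = r * c' -> exists e, c = r * e) ->
  b%:P * p = q * r%:P + y * F -> exists z w, p = z * r%:P + w * F.
Proof.
move=> uF tor E; have F0 : F != 0 by apply: contraTneq uF => ->; rewrite lead_coef0 unitr0.
have dE := Pdiv.IdomainUnit.divp_eq uF.
have E2 : b%:P * (p %% F) - (q %% F) * r%:P = (y - b%:P * (p %/ F) + (q %/ F) * r%:P) * F.
  apply/eqP; rewrite -subr_eq0.
  have -> : p %% F = p - p %/ F * F by rewrite {2}(dE p) addrC addKr.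
  have -> : q %% F = q - q %/ F * F by rewrite {2}(dE q) addrC addKr.
  have -> : b%:P * (p - p %/ F * F) = q * r%:P + y * F - b%:P * (p %/ F * F) by rewrite mulrBr E.
  by apply/eqP; ring.
have D0 : b%:P * (p %% F) - (q %% F) * r%:P = 0.
  apply/eqP; apply: contraT => D0; set W := (X in X * F) in E2.
  have W0 : W != 0 by apply: contra_neq D0 => W0; rewrite E2 W0 mul0r.
  have sF : (0 < size F)%N by rewrite size_poly_gt0.
  have : (size (b%:P * (p %% F) - (q %% F) * r%:P)%R < size F)%N.
    apply: leq_ltn_trans (size_polyD _ _) _; rewrite gtn_max size_polyN; apply/andP; split.
      by rewrite mul_polyC (leq_ltn_trans (size_scale_leq _ _)) ?ltn_modpN0.
    by rewrite mulrC mul_polyC (leq_ltn_trans (size_scale_leq _ _)) ?ltn_modpN0.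
  by rewrite E2 size_mul // ltnNge; move: (size_poly_gt0 W); rewrite W0; lia.
have /choice[e eP] : forall i, exists e, (p %% F)`_i = r * e.
  move=> i; apply: (tor _ (q %% F)`_i); apply/eqP; rewrite -subr_eq0.
  by have /polyP/(_ i) := D0; rewrite coefB coefCM coefMC coef0 [_ * r]mulrC => ->.
exists (\poly_(i < size (p %% F)) e i), (p %/ F); rewrite {1}(dE p) addrC; congr (_ + _).
apply/polyP => i; rewrite coefMC coef_poly mulrC; case: ltnP => si; first exact: eP.
by rewrite mulr0 nth_default.
Qed.

#[local] Opaque to_poly of_poly of_coef.

Section CompleteIntersection.
Variable K : closedFieldType.

Lemma principal_torsion m (f : {mpoly K[m.+1]}) : f != 0 ->
  exists a : 'I_m -> K, lead_coef (to_poly a f) \in GRing.unit /\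
  forall c x, c != 0 -> ideal_of [:: f] (of_coef a c * x) -> ideal_of [:: f] x.
Proof.
move=> /monic_shear[a ua]; exists a; split=> // c x c0 /ideal_of1[y E]; apply/ideal_of1.
have := congr1 (to_poly a) E; rewrite !rmorphM -(of_polyC a c) of_polyK.
case/(unit_lead_torsion ua c0) => z Ez; exists (of_poly a z).
by rewrite -[x](to_polyK a) Ez rmorphM to_polyK.
Qed.

Definition meet_codim2 m (f g : {mpoly K[m]}) :=
  forall P, is_prime P -> P f -> P g -> prime_chain [set 0] P 2.

(** By [chain_indep_le] such a prime has height at most one, so it cannot contain both f and g when
    [meet_codim2 f g] holds. *)
Lemma of_coef_avoiding m (a : 'I_m -> K) (I : set {mpoly K[m.+1]}) : is_ideal I ->
  (forall c, c != 0 -> ~ I (of_coef a c)) ->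
  exists P, [/\ is_prime P, I `<=` P & indep m P].
Proof.
move=> iI nI; have [| | |P [pP IP MP]] := prime_avoiding [set of_coef a c | c in [set c | c != 0]] iI.
- by exists 1; [exact: oner_neq0 | rewrite rmorph1].
- by move=> _ _ [c c0 <-] [d d0 <-]; exists (c * d); [exact: mulf_neq0 | rewrite rmorphM].
- by move=> _ [c c0 <-]; exact: nI.
exists P; split=> //; exists (of_coef a); split=> [c|F PF]; first exact: of_coefC.
by apply: contrapT => /eqP F0; apply: MP PF; exists F.
Qed.

Lemma colon_ideal (R : comNzRingType) (I : set R) x : is_ideal I -> is_ideal [set t | I (t * x)].
Proof.
move=> iI; split=> [|t u /= It Iu|r t /= It] /=.
- by rewrite mul0r; apply: (ideal0 iI).
- by rewrite mulrDl; apply: (idealD iI).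
- by rewrite -mulrA; apply: (idealMl _ iI).
Qed.

Lemma meet_codim2_regular m (f g a : {mpoly K[m.+1]}) : f != 0 -> meet_codim2 f g ->
  ideal_of [:: f] (g * a) -> ideal_of [:: f] a.
Proof.
move=> f0 fg ga; apply: contrapT => na; have iF := ideal_of_ideal [:: f].
have [s [us tor]] := principal_torsion f0.
have [|P [pP IP iP]] := of_coef_avoiding (a := s) (colon_ideal a iF).
  by move=> c c0 Ic; apply: na; apply: (tor c a c0).
have Pf : P f by apply: IP; apply: (idealMr _ iF); apply: mem_ideal_of; rewrite mem_head.
by have := chain_indep_le (fg _ pP Pf (IP _ ga)) iP; rewrite add2n ltnn.
Qed.

(* The ideal (f, g) contains a nonzero r free of the first variable; make f
   monic in that variable and r monic in a second one. If (f, g) contains c x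
   with c free of both, write r = al' f + ga' g: then ga' x = z r modulo f for
   some z, so r (x - z g) lies in (f), and r is regular modulo f. *)
Lemma complete_intersection_torsion m (f g : {mpoly K[m.+2]}) : f != 0 -> meet_codim2 f g ->
  exists (a : 'I_m.+1 -> K) (b : 'I_m -> K), forall c x, c != 0 ->
    ideal_of [:: f; g] (of_coef a (of_coef b c) * x) -> ideal_of [:: f; g] x.
Proof.
move=> f0 fg; have [a [ua tor]] := principal_torsion f0; exists a.
have iI := ideal_of_ideal [:: f; g].
have [r r0 Ir] : exists2 r, r != 0 & ideal_of [:: f; g] (of_coef a r).
  apply: contrapT => nr; have [|P [pP IP iP]] := of_coef_avoiding (a := a) iI.
    by move=> c c0 Ic; apply: nr; exists c.
  have Pf : P f by apply: IP; apply: mem_ideal_of; rewrite mem_head.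
  have Pg : P g by apply: IP; apply: mem_ideal_of; rewrite !inE eqxx orbT.
  by have := chain_indep_le (fg _ pP Pf Pg) iP; rewrite add2n ltnn.
have [b ub] := monic_shear r0; exists b => c x c0 /ideal_of2[al [ga Ex]].
have [al' [ga' Er]] := (iffLR (ideal_of2 _ _ _)) Ir.
have tor2 d d' : of_coef b c * d = r * d' -> exists e, d = r * e.
  move=> E; have := congr1 (to_poly b) E.
  rewrite !rmorphM -(of_polyC b c) of_polyK [X in _ = X]mulrC.
  case/(unit_lead_torsion ub c0) => z Ez; exists (of_poly b z).
  by rewrite -[d](to_polyK b) Ez rmorphM to_polyK mulrC.
have E : of_coef a (of_coef b c) * (ga' * x) = ga * of_coef a r + (ga' * al - ga * al') * f.
  have -> : of_coef a (of_coef b c) * (ga' * x) = ga' * (of_coef a (of_coef b c) * x) by ring.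
  rewrite Ex Er; ring.
have toK d : d%:P = to_poly a (of_coef a d) by rewrite -of_polyC of_polyK.
have := congr1 (to_poly a) E.
rewrite (rmorphM (to_poly a) (of_coef a (of_coef b c))) (rmorphD (to_poly a)).
rewrite (rmorphM (to_poly a) ga) (rmorphM (to_poly a) (ga' * al - ga * al')).
rewrite -(toK r) -(toK (of_coef b c)).
case/(unit_lead_torsion2 ua tor2) => z [w Ezw].
have {}Ezw : ga' * x = of_poly a z * of_coef a r + of_poly a w * f.
  have := congr1 (of_poly a) Ezw; rewrite to_polyK (rmorphD (of_poly a)).
  by rewrite (rmorphM (of_poly a) z) (rmorphM (of_poly a) w) to_polyK of_polyC.
have : ideal_of [:: f] (x - of_poly a z * g).
  apply: (tor r _ r0); apply: (iffRL (ideal_of1 _ _)).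
  exists (al' * (x - of_poly a z * g) + g * (of_poly a w + of_poly a z * al')).
  have -> : of_coef a r * (x - of_poly a z * g) =
    al' * f * (x - of_poly a z * g) + g * (ga' * x) - ga' * g * of_poly a z * g by rewrite Er; ring.
  rewrite Ezw Er; ring.
case/ideal_of1 => y Ey; apply/ideal_of2; exists y, (of_poly a z).
by rewrite -Ey subrK.
Qed.

(* A prime containing ((f, g) : x) and meeting the polynomial ring in m
   variables trivially has height at most two. *)
Lemma complete_intersection_unmixed m (f g x : {mpoly K[m.+2]}) : f != 0 -> meet_codim2 f g ->
  (forall P, ht2 P -> loc (ideal_of [:: f; g]) P x) -> ideal_of [:: f; g] x.
Proof.
move=> f0 fg lx; apply: contrapT => nx.
have iI := ideal_of_ideal [:: f; g]; have iJ := colon_ideal x iI.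
have [a [b tor]] := complete_intersection_torsion f0 fg.
have [| | |P [pP IP MP]] := prime_avoiding [set of_coef a (of_coef b c) | c in [set c | c != 0]] iJ.
- by exists 1; [exact: oner_neq0 | rewrite !rmorph1].
- by move=> _ _ [c c0 <-] [d d0 <-]; exists (c * d); [exact: mulf_neq0 | rewrite !rmorphM].
- by move=> _ [c c0 <-] Ic; apply: nx; apply: (tor c x c0).
have Pf : P f by apply: IP; apply: (idealMr _ iI); apply: mem_ideal_of; rewrite mem_head.
have Pg : P g.
  by apply: IP; apply: (idealMr _ iI); apply: mem_ideal_of; rewrite !inE eqxx orbT.
have iP : indep m P.
  exists (of_coef a \o of_coef b); split=> [c|F PF].
    by rewrite -[LHS]/(of_coef a (of_coef b _)) !of_coefC.
  by apply: contrapT => /eqP F0; apply: MP PF; exists F.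
have [|t [nt It]] := lx P; last by apply: nt; apply: IP.
split=> //; first exact: fg.
by move=> /chain_indep_le/(_ iP); rewrite addSn add2n ltnn.
Qed.

End CompleteIntersection.

(** * Homogeneity and Jacobian ideals *)

Section Homogeneity.
Variables (K : fieldType) (char0 : [pchar K] =i pred0) (m : nat).
Implicit Types (h : {mpoly K[m]}) (I P : set {mpoly K[m]}).

Definition scale_vars (c : K) : {rmorphism {mpoly K[m]} -> {mpoly K[m]}} :=
  mmap (@mpolyC m K) (fun i => c *: 'X_i).

Lemma scale_varsC c a : scale_vars c a%:MP = a%:MP.
Proof. exact: mmapC. Qed.

Lemma scale_varsX c i : scale_vars c 'X_i = c *: 'X_i.
Proof. by rewrite /= mmapX mmap1U. Qed.

Lemma scale_vars_homog c h d : h \is d.-homog -> scale_vars c h = c ^+ d *: h.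
Proof.
move=> /dhomogP hd; rewrite {2}[h]mpolyE scaler_sumr [LHS]/(mmap _ _ _).
apply: eq_big_seq => mm /hd /= <-; rewrite mul_mpolyC scalerA mulrC -scalerA; congr (_ *: _).
rewrite mpolyXE_id mdegE -prodrXr /mmap1.
under [LHS]eq_bigr do rewrite exprZn.
by rewrite scaler_prod.
Qed.

#[local] Opaque scale_vars.

Lemma scale_varsK a b : a * b = 1 -> cancel (scale_vars a) (scale_vars b).
Proof.
move=> ab; apply: (mpoly_rmorph_ext (u := scale_vars b \o scale_vars a) (v := idfun)) => [c|i] /=.
  by rewrite !scale_varsC.
by rewrite scale_varsX -mul_mpolyC rmorphM scale_varsC scale_varsX mul_mpolyC scalerA ab scale1r.
Qed.

Lemma natr_eq0 k : (k%:R == 0 :> K) = (k == 0%N).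
Proof. by move/pcharf0P: char0 => ->. Qed.

Lemma idealZ I c h : is_ideal I -> I h -> I (c *: h).
Proof. by move=> iI; rewrite -mul_mpolyC; apply: idealMl. Qed.

Lemma idealZK I c h : is_ideal I -> c != 0 -> I (c *: h) -> I h.
Proof. by move=> iI c0 /(idealZ c^-1 iI); rewrite scalerA mulVf // scale1r. Qed.

(* Applying X_i |-> 2 X_i and subtracting 2^N times the element kills the
   component of degree N and rescales the others by nonzero constants. *)
Lemma scale_vars_components I N (c : nat -> {mpoly K[m]}) : is_ideal I ->
  (forall h, I h -> I (scale_vars 2%:R h)) -> (forall d, c d \is d.-homog) ->
  I (\sum_(d < N) c d) -> forall d, (d < N)%N -> I (c d).
Proof.
move=> iI sI; elim: N c => [//|N IH] c hc Ic.
have cN : forall d, (d < N)%N -> I (c d).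
  move=> d dN; apply: (@idealZK _ (2%:R ^+ d - 2%:R ^+ N)) => //.
    rewrite -!natrX -oppr_eq0 opprB -natrB ?leq_exp2l ?(ltnW dN) //.
    by rewrite natr_eq0 subn_eq0 -ltnNge ltn_exp2l.
  apply: (IH (fun d => (2%:R ^+ d - 2%:R ^+ N) *: c d)) dN => [e|].
    exact: dhomogZ.
  have := idealB iI (sI _ Ic) (idealZ (2%:R ^+ N) iI Ic); congr I.
  rewrite rmorph_sum scaler_sumr -sumrB big_ord_recr /=.
  rewrite (scale_vars_homog _ (hc N)) subrr addr0; apply: eq_bigr => i _.
  by rewrite (scale_vars_homog _ (hc i)) scalerBl.
move=> d; rewrite ltnS leq_eqVlt => /predU1P[->|/cN//].
move: Ic; rewrite big_ord_recr /= addrC; apply: (ideal_addr iI).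
by apply: (ideal_sum _ iI) => i _; apply: cN.
Qed.

Lemma scale_vars_homogeneous I : is_ideal I ->
  (forall h, I h -> I (scale_vars 2%:R h)) -> forall h d, I h -> I (pihomog mdeg d h).
Proof.
move=> iI sI h d Ih.
have sz : (msize h <= maxn (msize h) d.+1)%N by rewrite leq_maxl.
apply: (scale_vars_components (c := fun d => pihomog mdeg d h) (N := maxn (msize h) d.+1)) => //.
- by move=> e; apply: pihomogP.
- by rewrite -pihomog_partitionE.
- by rewrite leq_max ltnSn orbT.
Qed.

Lemma dhomog_mderiv h d i : h \is d.-homog -> h^`M(i) \is d.-1.-homog.
Proof.
move=> /dhomogP hd; apply/dhomogP => mm; rewrite mcoeff_msupp mcoeff_deriv => nz.
have : (mm + U_(i))%MM \in msupp h.
  by rewrite mcoeff_msupp; apply: contra_neq nz => ->; rewrite mul0rn.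
by move/hd => /=; rewrite mdegD mdeg1 => <-; rewrite addn1.
Qed.

Lemma euler h d : h \is d.-homog -> \sum_i 'X_i * h^`M(i) = d%:R *: h.
Proof.
move=> /dhomogP hd; rewrite {2}[h]mpolyE scaler_sumr.
under eq_bigr => i _ do rewrite {1}[h]mpolyE raddf_sum mulr_sumr.
rewrite exchange_big /=; apply: eq_big_seq => mm /hd /= <-.
transitivity (\sum_i (mm i)%:R *: (h@_mm *: 'X_[mm])); last first.
  by rewrite -scaler_suml mdegE natr_sum.
apply: eq_bigr => i _; rewrite mderivZ mderivX.
have [->|mi] := eqVneq (mm i) 0%N; first by rewrite !scale0r scaler0 mulr0.
rewrite -!scalerAr -mpolyXD addmC submK ?lep1mP // !scalerA mulrC //.
Qed.

End Homogeneity.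

#[local] Opaque scale_vars.

(** * Local form of Jacobian ideals, minors and smooth points *)

Section Jacobian.
Variables (K : closedFieldType) (char0 : [pchar K] =i pred0) (n : nat).
Notation S := {mpoly K[n.+1]}.
Implicit Types (f g h p q x : S) (I P : set S).

Lemma jac_ideal h : is_ideal (jac h).
Proof. exact: ideal_of_ideal. Qed.

Lemma mem_jac h i : jac h h^`M(i).
Proof. by apply: mem_ideal_of; apply: map_f; rewrite mem_enum. Qed.

Lemma jac_min h I : is_ideal I -> (forall i, I h^`M(i)) -> jac h `<=` I.
Proof. by move=> iI hI; apply: ideal_of_min => // _ /mapP[i _ ->]. Qed.

Lemma jac_euler h d : (0 < d)%N -> h \is d.-homog -> jac h h.
Proof.
move=> d0 hd; have d1 : d%:R != 0 :> K by rewrite natr_eq0 // -lt0n.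
apply: (idealZK (jac_ideal h) d1).
rewrite -(euler hd); apply: (ideal_sum _ (jac_ideal h)) => i _.
exact: (idealMl _ (jac_ideal h) (mem_jac i)).
Qed.

Lemma jac_scale_vars h d x : h \is d.-homog -> jac h x -> jac h (scale_vars n.+1 2%:R x).
Proof.
move=> hd; have iJ := jac_ideal h.
apply: (jac_min (preimage_ideal (scale_vars n.+1 2%:R) iJ)) => i.
rewrite /preimage /= (scale_vars_homog _ (dhomog_mderiv i hd)); apply: (idealZ _ iJ); exact: mem_jac.
Qed.

Lemma jac_homogeneous h d : h \is d.-homog -> homogeneous_ideal (jac h).
Proof.
move=> hd; have iJ := jac_ideal h; split=> //; apply: scale_vars_homogeneous => //.
by move=> x; apply: jac_scale_vars hd.
Qed.

(** Both inclusions are the product rule: the terms with a factor h, respectively [h * u], are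
    absorbed since these forms lie in their own Jacobian ideals. The denominator needed is
    [u * u]. *)
Lemma loc_jac_mul P h u : is_prime P -> ~ P u -> jac h h -> jac (h * u) (h * u) ->
  loc (jac (h * u)) P = loc (jac h) P.
Proof.
move=> pP nu Jh Jhu; apply/seteqP; split; apply: loc_sub => //.
  apply: jac_min; first exact: loc_ideal pP (jac_ideal h).
  move=> i; apply: sub_loc => //; rewrite mderivM; have iJ := jac_ideal h.
  by apply: (idealD iJ); apply: (idealMr _ iJ) => //; exact: mem_jac.
apply: jac_min; first exact: loc_ideal pP (jac_ideal _).
move=> i; exists (u * u); split; first exact: primeNM.
have -> : u * u * h^`M(i) = u * (h * u)^`M(i) - u^`M(i) * (h * u) by rewrite mderivM; ring.
have iJ := jac_ideal (h * u).
by apply: (idealB iJ); apply: (idealMl _ iJ) => //; exact: mem_jac.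
Qed.

(** If all minors vanish, each column (x, y) gives a left kernel vector (-y, x); full row rank makes
    it zero, so the matrix is zero. *)
Lemma rank2_minor (F : fieldType) N (M : 'M[F]_(2, N)) : \rank M = 2%N ->
  exists j k, M 0 j * M 1 k - M 0 k * M 1 j != 0.
Proof.
move=> rM; apply: contrapT => nM.
have minor0 j k : M 0 j * M 1 k = M 0 k * M 1 j.
  apply/eqP; rewrite -subr_eq0; apply: contrapT => /negP ne; apply: nM.
  by exists j, k.
have free : row_free M by rewrite /row_free rM.
have ker (v : 'rV_2) : v *m M = 0 -> v = 0.
  by move=> E; apply: (row_free_inj free); rewrite E mul0mx.
have M0 : M <> 0.
  by move=> M0; move: rM; rewrite M0 mxrank0.
have z0 j0 : M 0 j0 = 0 /\ M 1 j0 = 0.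
  pose v : 'rV_2 := \row_i (if i == 0 then - M 1 j0 else M 0 j0).
  have /rowP v0 : v = 0.
    apply: ker; apply/rowP => k; rewrite !mxE big_ord_recl big_ord1 !mxE /=.
    rewrite (_ : lift ord0 ord0 = 1); last exact: val_inj.
    by rewrite mulNr mulrC -minor0 mulrC addrC; apply/eqP; rewrite subr_eq0 mulrC.
  split; first by have := v0 1; rewrite !mxE.
  by have := v0 0; rewrite !mxE /= => /eqP; rewrite oppr_eq0 => /eqP.
apply: M0; apply/matrixP => i j; rewrite mxE.
case: (z0 j); case: i => [[|[|//]] Hi] z1 z2.
  by rewrite -[RHS]z1; congr (M _ _); apply/val_inj.
by rewrite -[RHS]z2; congr (M _ _); apply/val_inj.
Qed.

Definition minor p q j k : S := p^`M(j) * q^`M(k) - p^`M(k) * q^`M(j).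

Lemma smooth_point p q (a : 'I_n.+1 -> K) :
  smooth_complete_intersection [tuple p; q] -> (exists i, a i != 0) ->
  p.@[a] = 0 -> q.@[a] = 0 -> exists j k, (minor p q j k).@[a] != 0.
Proof.
move=> [_ sm] a0 pa qa; have [|j [k]] := @rank2_minor _ _ _ (sm a a0 _).
  by move=> [[|[|//]] Hi]; rewrite (tnth_nth 0).
move=> jk; exists j, k; move: jk; rewrite !mxE !(tnth_nth 0) /=.
by rewrite mevalB !mevalM.
Qed.

(** Smoothness speaks of closed points only. The Nullstellensatz supplies a zero of P with nonzero
    i-th coordinate, and a minor that does not vanish there is outside P. *)
Lemma smooth_minor p q P i : smooth_complete_intersection [tuple p; q] ->
  is_prime P -> P p -> P q -> ~ P 'X_i -> exists j k, ~ P (minor p q j k).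
Proof.
move=> sm pP Pp Pq nX; have [a [Pa]] := nullstellensatz pP nX.
rewrite mevalXU => ai; have [|j [k jk]] := smooth_point sm _ (Pa _ Pp) (Pa _ Pq).
  by exists i.
by exists j, k => /Pa /eqP; rewrite (negPf jk).
Qed.

Lemma minor_out P p q j k : is_prime P -> ~ P (minor p q j k) ->
  (exists i, ~ P p^`M(i)) /\ (exists i, ~ P q^`M(i)).
Proof.
move=> pP nm; have iP := prime_ideal pP; split; apply: contrapT => nP; apply: nm.
  have Pd i : P p^`M(i) by apply: contrapT => ?; apply: nP; exists i.
  by apply: (idealB iP); apply: (idealMr _ iP).
have Pd i : P q^`M(i) by apply: contrapT => ?; apply: nP; exists i.
by apply: (idealB iP); apply: (idealMl _ iP).
Qed.

(* Cramer's rule for the partial derivatives of p q. *)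
Lemma jac_minor p q j k : jac (p * q) (minor p q j k * p) /\ jac (p * q) (minor p q j k * q).
Proof.
have iJ := jac_ideal (p * q).
have -> : minor p q j k * p = (p * q)^`M(k) * p^`M(j) - (p * q)^`M(j) * p^`M(k).
  by rewrite /minor !mderivM; ring.
have -> : minor p q j k * q = (p * q)^`M(j) * q^`M(k) - (p * q)^`M(k) * q^`M(j).
  by rewrite /minor !mderivM; ring.
by split; apply: (idealB iJ); apply: (idealMr _ iJ); exact: mem_jac.
Qed.

Lemma loc_jac_minor P p q j k : is_prime P -> ~ P (minor p q j k) ->
  loc (jac (p * q)) P = loc (ideal_of [:: p; q]) P.
Proof.
move=> pP nm; apply/seteqP; split; apply: loc_sub => //.
  apply: jac_min; first exact: loc_ideal pP (ideal_of_ideal _).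
  move=> i; apply: sub_loc => //; rewrite mderivM; apply/ideal_of2.
  by exists q^`M(i), p^`M(i); ring.
have [Jp Jq] := jac_minor p q j k.
apply: ideal_of_min; first exact: loc_ideal pP (jac_ideal _).
by move=> x; rewrite !inE => /orP[]/eqP ->; exists (minor p q j k).
Qed.

(** If P contained all variables, every polynomial would be constant modulo P, so P would have
    height n + 1 >= 3. *)
Lemma ht2_var P : (2 <= n)%N -> ht2 P -> exists i, ~ P 'X_i.
Proof.
move=> n2 [pP _ n3]; apply: contrapT => nX; have iP := prime_ideal pP.
have PX i : P 'X_i by apply: contrapT => ?; apply: nX; exists i.
have const h : exists c, P (h - c%:MP).
  elim/mpolyind: h => [|c mm h _ _ [b Pb]]; first by exists 0; rewrite subrr; apply: (ideal0 iP).
  have [m0|/eqP] := eqVneq mm 0%MM.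
    exists (c + b); rewrite m0 mpolyX0 mpolyCD -mul_mpolyC mulr1.
    by rewrite (_ : _ - _ = h - b%:MP) //; ring.
  move=> m0; exists b; rewrite -addrA; apply: (idealD iP) => //; apply: (idealZ _ iP).
  have [i mi] : exists i, mm i != 0%N.
    apply: contrapT => nm; apply: m0; apply/mnmP => i; rewrite mnm0E; apply/eqP.
    by apply: contrapT => /negP mi; apply: nm; exists i.
  by rewrite -(submK (_ : U_(i) <= mm)%MM) ?lep1mP // mpolyXD; apply: (idealMl _ iP).
have gr : growth_le P 0.
  exists 1%N => d; exists unit, (fun=> 1); split=> [|h _]; first by rewrite card_unit.
  have [c Pc] := const h; exists (fun=> c).
  by rewrite (big_pred1 tt) => [|[]//]; rewrite -mul_mpolyC mulr1.
have [k [r [_ [kr ck _ _ ir]]]] := prime_tower pP.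
have r0 := indep_growth iP gr ir.
by apply: n3; apply: prime_chain_le ck; lia.
Qed.

(* At a height two prime P the local ring is regular: P is generated by two
   elements h0, h1 there, and the minor of (p, q) is, modulo P, the one of
   (h0, h1) times the determinant expressing (p, q) through (h0, h1). *)
Lemma minor_generates P p q j k : ht2 P -> P p -> P q -> ~ P (minor p q j k) ->
  P `<=` loc (ideal_of [:: p; q]) P.
Proof.
move=> [pP _ n3] Pp Pq nm; have iP := prime_ideal pP.
have [d [r [s [_ cd [sd sP] lP _]]]] := prime_tower pP.
have d2 : (d <= 2)%N.
  by rewrite leqNgt; apply/negP => d3; apply: n3; apply: prime_chain_le cd.
have [h0 [h1 [Ph0 Ph1 hP]]] : exists h0 h1, [/\ P h0, P h1 & P `<=` loc (ideal_of [:: h0; h1]) P].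
  have key h0 h1 : (forall x, x \in s -> x \in [:: h0; h1]) -> P `<=` loc (ideal_of [:: h0; h1]) P.
    move=> sub; apply: (subset_trans lP) => x [t [nt It]]; exists t; split; first exact: nt.
    apply: (ideal_of_min (ideal_of_ideal _)) It => y /sub.
    exact: mem_ideal_of.
  have P0 := ideal0 iP.
  (* Missing generators are replaced by 0. *)
  case: s sd sP key {lP} => [|h0 [|h1 [|h2 s]]] sd sP key; last by move: d2; rewrite -sd.
  - by exists 0, 0; split=> //; apply: key.
  - exists h0, 0; split=> //; [by apply: sP; rewrite mem_head | apply: key => x].
    by rewrite !inE => ->.
  - exists h0, h1; split; [by apply: sP; rewrite mem_head| |exact: key].
    by apply: sP; rewrite !inE eqxx orbT.
have [t [nt /ideal_of2[a [b Ep]]]] := hP _ Pp.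
have [u [nu /ideal_of2[c [e Eq]]]] := hP _ Pq.
(* In the derivative of the relation, the terms where w or a component of z is differentiated keep a
   factor from P. *)
have Pd w y z x0 x1 i : P y -> P x0 -> P x1 -> w * y = z.1 * x0 + z.2 * x1 ->
    P (w * y^`M(i) - (z.1 * x0^`M(i) + z.2 * x1^`M(i))).
  move=> Py P0 P1 E; have := congr1 (mderiv i) E; rewrite mderivD !mderivM => E'.
  have -> : w * y^`M(i) - (z.1 * x0^`M(i) + z.2 * x1^`M(i)) =
      z.1^`M(i) * x0 + z.2^`M(i) * x1 - w^`M(i) * y.
    by apply/eqP; rewrite subr_eq -addrA eq_sym -subr_eq0; apply/eqP;
       rewrite -[RHS](subrr (w^`M(i) * y + w * y^`M(i))) {1}E'; ring.
  by apply: (idealB iP); [apply: (idealD iP)|]; apply: (idealMl _ iP).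
pose A i := t * p^`M(i) - (a * h0^`M(i) + b * h1^`M(i)).
pose B i := u * q^`M(i) - (c * h0^`M(i) + e * h1^`M(i)).
have dp i : P (A i) by exact: (Pd t p (a, b) h0 h1).
have dq i : P (B i) by exact: (Pd u q (c, e) h0 h1).
have nD : ~ P (a * e - b * c).
  move=> PD; have : P (t * u * minor p q j k); last by apply: primeNM => //; exact: primeNM.
  have -> : t * u * minor p q j k = (a * e - b * c) * minor h0 h1 j k
    + (A j * (u * q^`M(k)) - A k * (u * q^`M(j)))
    + (B k * (a * h0^`M(j) + b * h1^`M(j)) - B j * (a * h0^`M(k) + b * h1^`M(k))).
    by rewrite /A /B /minor /=; ring.
  apply: (idealD iP); last by apply: (idealB iP); apply: (idealMr _ iP).
  by apply: (idealD iP); [apply: (idealMr _ iP) | apply: (idealB iP); apply: (idealMr _ iP)].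
have iI := ideal_of_ideal [:: p; q].
apply: (subset_trans hP); apply: (loc_sub pP).
apply: (ideal_of_min (loc_ideal pP iI)) => x.
rewrite !inE => /orP[]/eqP ->; exists (a * e - b * c); (split; first exact: nD);
  apply: (iffRL (ideal_of2 _ _ _)).
  exists (e * t), (- b * u).
  have -> : e * t * p + - b * u * q = e * (t * p) - b * (u * q) by ring.
  by rewrite Ep Eq; ring.
exists (- c * t), (a * u).
have -> : - c * t * p + a * u * q = a * (u * q) - c * (t * p) by ring.
by rewrite Ep Eq; ring.
Qed.

Lemma complete_intersection_local p q P x i : smooth_complete_intersection [tuple p; q] ->
  ht2 P -> P p -> P q -> ~ P 'X_i -> P x -> loc (ideal_of [:: p; q]) P x.
Proof.
move=> sm hP Pp Pq nX Px; have [pP _ _] := hP.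
have [j [k nm]] := smooth_minor sm pP Pp Pq nX.
exact: minor_generates hP Pp Pq nm _ Px.
Qed.

End Jacobian.

(** * Projective intersections *)

Lemma pihomogM_homog (K : comNzRingType) m (y g : {mpoly K[m]}) d e : g \is d.-homog ->
  pihomog mdeg e (y * g) = if (d <= e)%N then pihomog mdeg (e - d) y * g else 0.
Proof.
move=> hg; have le : (msize y <= maxn (msize y) (e - d).+1)%N by rewrite leq_maxl.
rewrite {1}(pihomog_partitionE le) mulr_suml raddf_sum /=.
have hk k : pihomog mdeg k y * g \is (k + d).-homog by apply: dhomogM => //; exact: pihomogP.
case: leqP => de.
  have lt : (e - d < maxn (msize y) (e - d).+1)%N by rewrite leq_max ltnSn orbT.
  have he := hk (e - d)%N; rewrite subnK // in he.
  rewrite (bigD1 (Ordinal lt)) //= (pihomog_dE he) big1 ?addr0 // => k.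
  rewrite -val_eqE /= => ne; apply: pihomog_ne0 (hk k).
  by apply: contraNneq ne => E; apply/eqP; lia.
rewrite big1 // => k _; apply: pihomog_ne0 (hk k).
by rewrite gtn_eqF // (leq_trans de) // leq_addl.
Qed.

Lemma dhomog_msize_le (K : comNzRingType) m (h : {mpoly K[m]}) d :
  h \is d.-homog -> (msize h <= d.+1)%N.
Proof.
move=> /dhomogP hd; rewrite msizeE; apply/bigmax_leqP_seq => mm /hd /= -> _.
exact: leqnn.
Qed.

Section Cone.
Variables (K : closedFieldType) (n : nat).
Notation S := {mpoly K[n.+1]}.

(** S / P is spanned over K[g] by the monomials of degree below M: modulo I, a larger one is g times
    something of lower degree. [V e] collects the combinations with powers of g below e, so its
    spanning set grows linearly in e. *)
Lemma cone_growth (I P : set S) (g : S) d : homogeneous_ideal I -> is_ideal P -> I `<=` P ->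
  (0 < d)%N -> g \is d.-homog ->
  (forall i, exists N x y, I x /\ 'X_i ^+ N = x + y * g) -> growth_le P 1.
Proof.
move=> [iI hI] iP IP d0 gd /choice[N /choice[x_ /choice[y_ Ixy]]].
(* In degree at least M some exponent reaches [N i], so the relation for ['X_i ^+ N i] can be
   used. *)
pose M := (\sum_i N i).+1.
pose V e (h : S) := exists c : 'X_{1..n.+1 < M} -> nat -> K,
  P (h - \sum_b \sum_(j < e) c b j *: ('X_[b] * g ^+ j)).
have VP e h : P h -> V e h.
  move=> Ph; exists (fun _ _ => 0); rewrite big1 ?subr0 // => b _.
  by rewrite big1 // => j _; rewrite scale0r.
have VD e h h' : V e h -> V e h' -> V e (h + h').
  move=> [c Pc] [c' Pc']; exists (fun b j => c b j + c' b j).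
  have := idealD iP Pc Pc'; congr P; rewrite addrACA -opprD -big_split; congr (_ - _).
  apply: eq_bigr => b _ /=; rewrite -big_split; apply: eq_bigr => j _ /=.
  by rewrite scalerDl.
have VZ e a h : V e h -> V e (a *: h).
  move=> [c Pc]; exists (fun b j => a * c b j).
  have := idealZ a iP Pc; congr P; rewrite scalerBr scaler_sumr; congr (_ - _).
  apply: eq_bigr => b _; rewrite scaler_sumr; apply: eq_bigr => j _.
  by rewrite scalerA.
have Vg e h : V e h -> V e.+1 (h * g).
  move=> [c Pc]; exists (fun b j => if j is j'.+1 then c b j' else 0).
  have := idealMr g iP Pc; congr P; rewrite mulrBl mulr_suml; congr (_ - _).
  apply: eq_bigr => b _; rewrite big_ord_recl scale0r add0r mulr_suml.
  by apply: eq_bigr => j _; rewrite -scalerAl -mulrA -exprSr.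
have all e h : (msize h <= e)%N -> V e h.
  elim: e h => [|e IH] h he.
    apply: VP; suff -> : h = 0 by apply: (ideal0 iP).
    by apply/eqP; rewrite -msize_poly_eq0 -leqn0.
  rewrite [h]mpolyE big_seq; apply: (big_ind (V e.+1)) => [|u v|mm hm].
  - by apply: VP; apply: (ideal0 iP).
  - exact: VD.
  apply: VZ; have me : (mdeg mm <= e)%N by rewrite -ltnS (leq_trans (msize_mdeg_lt hm)).
  have [mM|Mm] := ltnP (mdeg mm) M.
    exists (fun b j => ((b == BMultinom mM) && (j == 0%N))%:R).
    rewrite (bigD1 (BMultinom mM)) //= big_ord_recl eqxx expr0 mulr1 scale1r.
    rewrite big1 => [|j _]; last by rewrite andbF scale0r.
    rewrite big1 => [|b /negPf ->]; last by rewrite big1 // => j _; rewrite scale0r.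
    by rewrite !addr0 subrr; apply: (ideal0 iP).
  have [i Ni] : exists i, (N i <= mm i)%N.
    apply: contrapT => nN; move: Mm; rewrite /M ltnNge => /negP; apply.
    rewrite mdegE; apply: leq_sum => i _; apply: ltnW; rewrite ltnNge.
    by apply/negP => Ni; apply: nN; exists i.
  have [Ix E] := Ixy i.
  pose mm' := (mm - U_(i) *+ N i)%MM.
  have Em : mm = (mm' + U_(i) *+ N i)%MM.
    rewrite /mm' submK //; apply/mnm_lepP => j; rewrite mulmnE mnm1E.
    by case: eqP => [<-|_]; rewrite ?mul1n.
  have XE : 'X_[mm] = 'X_[mm'] * 'X_i ^+ N i :> S by rewrite {1}Em mpolyXD mpolyXn.
  have hom : ('X_i ^+ N i : S) \is (N i).-homog.
    by rewrite -[X in X.-homog]mul1n; apply: dhomogMn; rewrite dhomogX /= mdeg1.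
  (* The component of degree [N i] of the relation has a homogeneous cofactor of g, of degree
     [N i - d]; as d > 0, the induction applies to it. *)
  have := pihomog_dE hom; rewrite {1}E raddfD /= (pihomogM_homog _ _ gd).
  have Px : P ('X_[mm'] * pihomog mdeg (N i) (x_ i)).
    by apply: (idealMl _ iP); apply: IP; apply: hI.
  case: leqP => dN EX; last first.
    by apply: VP; rewrite XE -EX addr0.
  rewrite XE -EX mulrDr; apply: VD; first exact: VP.
  rewrite mulrA; apply: Vg; apply: IH.
  have s1 : (msize ('X_[mm'] : S) <= (mdeg mm').+1)%N.
    by apply: dhomog_msize_le; rewrite dhomogX.
  apply: leq_trans (msizeM_leS s1 (dhomog_msize_le (pihomogP mdeg (N i - d) (y_ i)))) _.
  by have := congr1 (@mdeg _) Em; rewrite mdegD mdegMn mdeg1; lia.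
exists #|{: 'X_{1..n.+1 < M}}| => e.
exists ('X_{1..n.+1 < M} * 'I_e)%type, (fun bj : 'X_{1..n.+1 < M} * 'I_e => 'X_[bj.1] * g ^+ bj.2).
split=> [|h he]; first by rewrite card_prod card_ord expn1 leq_mul.
have [c Pc] := all _ _ he; exists (fun bj : 'X_{1..n.+1 < M} * 'I_e => c bj.1 bj.2).
by move: Pc; rewrite pair_bigA.
Qed.

End Cone.

(* If I + (g) has no zero in projective space, then S / P is finite over K[g],
   so at most one element of S is transcendental modulo P. *)
Lemma no_projective_zero (K : closedFieldType) n (I P : set {mpoly K[n.+1]}) (g : {mpoly K[n.+1]}) d :
  homogeneous_ideal I -> is_prime P -> I `<=` P -> (0 < d)%N -> g \is d.-homog ->
  (forall a : 'I_n.+1 -> K, (forall h, I h -> h.@[a] = 0) -> g.@[a] = 0 -> forall i, a i = 0) ->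
  prime_chain [set 0] P n.
Proof.
move=> hI pP IP d0 gd nz; have iI := hI.1; have iP := prime_ideal pP.
pose J : set {mpoly K[n.+1]} := [set w | exists2 x, I x & exists y, w = x + y * g].
have iJ : is_ideal J.
  split=> [|_ _ [x Ix [y ->]] [x' Ix' [y' ->]]|r _ [x Ix [y ->]]].
  - by exists 0; [apply: (ideal0 iI) | exists 0; rewrite mul0r addr0].
  - by exists (x + x'); [apply: (idealD iI) | exists (y + y'); rewrite mulrDl addrACA].
  - by exists (r * x); [apply: (idealMl _ iI) | exists (r * y); rewrite mulrDr mulrA].
have pow i : exists N x y, I x /\ 'X_i ^+ N = x + y * g.
  apply: contrapT => nN; have [|Q [pQ JQ nX]] := prime_over (x := 'X_i) iJ.
    by move=> k [x Ix [y E]]; apply: nN; exists k, x, y.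
  have [a [Qa]] := nullstellensatz pQ nX; rewrite mevalXU nz ?eqxx // => [h Ih|].
    by apply/Qa/JQ; exists h => //; exists 0; rewrite mul0r addr0.
  apply/Qa/JQ; exists 0; [exact: (ideal0 iI) | exists 1].
  by rewrite mul1r add0r.
have [k [r [_ [kr ck _ _ ir]]]] := prime_tower pP.
have r1 := indep_growth iP (cone_growth hI iP IP d0 gd pow) ir.
by apply: prime_chain_le ck; lia.
Qed.

(** * Top-dimensional parts *)

Section Top.
Variable R : comNzRingType.
Implicit Types (I T P : set R) (x : R).

(** What is retained of a top part: unlike [is_top] it refers to no ideal I, and it passes to the
    radical, so T and its radical share the arguments below. *)
Definition pure_codim2 T := exists m (Q : 'I_m -> set R) (A : pred 'I_m),
  (forall i, A i -> is_primary (Q i) /\ ht2 (radical (Q i))) /\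
  T = \bigcap_(i in [set i | A i]) Q i.

Lemma top_pure I T : is_top I T -> pure_codim2 T.
Proof.
move=> [m [Q [[_ pQ _ _] ->]]]; exists m, Q, (fun i => `[< has_codim (Q i) 2 >]); split.
  by move=> i /asboolP ci; split=> //; apply/has_codim2P.
by apply: eq_bigcapl; split=> i /=; rewrite asboolE.
Qed.

(* When I has height at least two its components of height two are isolated. *)
Lemma topP I T x : height_ge I 2 -> is_top I T ->
  T x <-> forall P, ht2 P -> loc I P x.
Proof.
move=> hI [m [Q [[IE pQ _ _] ->]]]; split=> [Tx P hP|lx i /= ci].
  have [pP _ n3] := hP; have [] := @loc_seq _ P _ predT Q x pP.
  - by move=> i _; apply: primary_ideal.
  - move=> i _; have [ci|nci] := pselect (has_codim (Q i) 2).
      by apply: sub_loc => //; apply: Tx.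
    (* A component inside P would have height two: at least two because it contains I, at most two
       because of P. *)
    have /existsNP[t /not_implyP[Qt nt]] : ~ Q i `<=` P.
      move=> QP; apply: nci; split.
        move=> P' pP' QP'; apply: hI => //; apply: subset_trans QP'.
        by rewrite IE => y; apply.
      by move=> h3; apply/n3/h3.
    by apply: loc_out Qt nt => //; apply: primary_ideal.
  - by move=> t [nt It]; exists t; split=> //; rewrite IE => i _; apply: It.
have hP : ht2 (radical (Q i)) by apply/has_codim2P.
have [t [nt It]] := lx _ hP; have : Q i (t * x) by move: It; rewrite IE; apply.
by case: (pQ i) => _ _ QM; rewrite mulrC => /QM[].
Qed.

Lemma pure_ideal T : pure_codim2 T -> is_ideal T.
Proof.
move=> [m [Q [A [hQ ->]]]]; apply: ideal_bigcap => i /hQ[pQ _].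
exact: primary_ideal.
Qed.

Lemma radical_pure T : pure_codim2 T -> pure_codim2 (radical T).
Proof.
move=> [m [Q [A [hQ ->]]]]; exists m, (fun i => radical (Q i)), A; split.
  move=> i /hQ[pQ h2]; have pr := primary_radical_prime pQ.
  by split; [exact: prime_primary | rewrite prime_radical].
apply/seteqP; split=> [x [k xk] i Ai|x rx]; first by exists k; apply: xk.
have /choice[k kP] : forall i, exists k, A i -> Q i (x ^+ k).
  by move=> i; case Ai: (A i); [have [k] := rx _ Ai; exists k | exists 0%N].
exists (\sum_i k i)%N => i /= Ai; have [pQ _] := hQ _ Ai.
rewrite (bigD1 i) //= exprD; apply: (idealMr _ (primary_ideal pQ)).
exact: kP.
Qed.

(** The lowest prime of the chain contains some component, hence its radical, which has height two
    and can serve as base of the chain. *)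
Lemma pure_chain T P k : pure_codim2 T -> prime_chain T P k ->
  exists P0, [/\ ht2 P0, T `<=` P0 & prime_chain P0 P k].
Proof.
move=> [m [Q [A [hQ ->]]]]; elim: k P => [|k IH] P.
  move=> /prime_chain0[pP TP]; have [i Ai QP] : exists2 i, A i & Q i `<=` P.
    by apply: prime_bigcap => // i /hQ[pQ _]; apply: primary_ideal.
  have [pQ h2] := hQ _ Ai; exists (radical (Q i)); split=> //.
    by move=> x /(_ i Ai); apply: sub_radical.
  by apply/prime_chain0; split=> //; apply: radical_prime_sub.
move=> /prime_chainS[P' [/IH[P0 [h2 TP0 c]] pP sP]]; exists P0; split=> //.
by apply/prime_chainS; exists P'.
Qed.

Lemma pure_minimal_prime T P : pure_codim2 T -> is_minimal_prime T P -> has_codim P 2.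
Proof.
move=> pT [pP TP minP]; have [|P0 [h2 TP0 /prime_chain0[_ P0P]]] := @pure_chain _ P 0 pT.
  exact/prime_chain0.
have [pP0 _ _] := h2.
rewrite -(minP P0) // has_codim2P ?prime_radical //; exact: prime_primary.
Qed.

End Top.

(** * Homogeneity, saturation and local Cohen-Macaulayness of pure ideals *)

Section ProjectiveTop.
Variables (K : closedFieldType) (char0 : [pchar K] =i pred0) (n : nat).
Notation S := {mpoly K[n.+1]}.
Implicit Types (I T P : set S) (h x u v : S).

Let scaleK : cancel (scale_vars n.+1 2%:R) (scale_vars n.+1 (2%:R^-1 : K)).
Proof. by apply: scale_varsK; rewrite mulfV // natr_eq0. Qed.

Let scaleVK : cancel (scale_vars n.+1 (2%:R^-1 : K)) (scale_vars n.+1 2%:R).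
Proof. by apply: scale_varsK; rewrite mulVf // natr_eq0. Qed.

Lemma ht2_scale_vars P : ht2 P -> ht2 (scale_vars n.+1 2%:R @^-1` P).
Proof.
move=> [pP c2 n3]; split; first exact: preimage_prime.
  by apply: preimage_chain => // y; exists (scale_vars n.+1 2%:R^-1 y); apply: scaleVK.
move=> c3; apply: n3.
have -> : P = scale_vars n.+1 2%:R^-1 @^-1` (scale_vars n.+1 2%:R @^-1` P).
  by apply/funext => x; congr P; apply/esym/scaleVK.
by apply: preimage_chain => // y; exists (scale_vars n.+1 2%:R y); apply: scaleK.
Qed.

(** The description by [topP] does not mention the components, and the automorphism X_i |-> 2 X_i
    permutes the height two primes. *)
Lemma top_scale_vars I T x : height_ge I 2 -> is_top I T ->
  (forall y, I y -> I (scale_vars n.+1 2%:R y)) -> T x -> T (scale_vars n.+1 2%:R x).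
Proof.
move=> hI tT sI /(topP _ hI tT) Tx; apply/(topP _ hI tT) => P hP.
have [t [nt It]] := Tx _ (ht2_scale_vars hP).
by exists (scale_vars n.+1 2%:R t); split=> //; rewrite -rmorphM; apply: sI.
Qed.

(** The radical of each component has height two and so omits some variable, whose powers can be
    cancelled modulo that component. *)
Lemma pure_saturated T : (2 <= n)%N -> pure_codim2 T -> saturated T.
Proof.
move=> n2 [m [Q [A [hQ ->]]]] h [k hk] i /= Ai; have [pQ h2] := hQ _ Ai.
have [j nX] := ht2_var n2 h2; have [_ _ QM] := pQ.
have := hk (U_(j) *+ k)%MM; rewrite mdegMn mdeg1 mul1n => /(_ erefl i Ai).
rewrite -mpolyXn mulrC => /QM[//|rX]; exfalso; apply: nX.
exact: primeX (primary_radical_prime pQ) rX.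
Qed.

Lemma pure_codim_two_ideal T : (2 <= n)%N -> pure_codim2 T ->
  (forall x, T x -> T (scale_vars n.+1 2%:R x)) -> T = setT \/ codim_two_ideal T.
Proof.
move=> n2 pT sT; have iT := pure_ideal pT.
have [T1|nT1] := pselect (T 1); [left; exact: ideal_setT | right; split=> //].
- by split=> //; apply: scale_vars_homogeneous.
- exact: pure_saturated.
- by move=> P; apply: pure_minimal_prime.
Qed.

Lemma chain_dim P k : prime_chain [set 0] P k -> (k <= n.+1)%N.
Proof.
move=> cP; rewrite -[k]addn0; apply: (chain_indep_le cP).
have pP := prime_chain_prime cP.
exists (mmap (@mpolyC n.+1 K) (fun=> 0)); split=> [c|F]; first exact: mmapC.
rewrite [F]nvar0_mpolyC => PF; have [->|c0] := eqVneq (F@_0) 0; first by rewrite mpolyC0.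
exfalso; apply: (prime1 pP); rewrite -mpolyC1 -(mulVf c0) mpolyCM.
apply: (idealMl _ (prime_ideal pP)); move: PF; congr P; exact: mmapC.
Qed.

(** A homogeneous prime lies in the irrelevant ideal, strictly if it omits a variable, so a chain
    ending at it can be lengthened by one. *)
Lemma homogeneous_chain_dim P k i : homogeneous_ideal P -> ~ P 'X_i ->
  prime_chain [set 0] P k -> (k <= n)%N.
Proof.
move=> [iP hP] nX cP; pose M0 := (mcoeff (0%MM : 'X_{1..n.+1}) : {rmorphism S -> K}) @^-1` [set 0].
apply: (@chain_dim M0 k.+1); apply/prime_chainS; exists P.
split=> //; first exact/preimage_prime/zero_prime.
split=> [h Ph|sM]; last first.
  by apply: nX; apply: sM; rewrite /M0 /preimage /= mcoeffX mnm1_eq0.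
apply: contrapT => h0; apply: (prime1 (prime_chain_prime cP)).
have {}h0 : h@_0 != 0 by apply/eqP.
rewrite -mpolyC1 -(mulVf h0) mpolyCM; apply: (idealMl _ iP).
have -> : (h@_0)%:MP = pihomog mdeg 0 h; last exact: hP.
apply/mpolyP => mm; rewrite pihomogE raddf_sum mcoeffC /=.
rewrite big_mkcond; have [->|m0] := eqVneq mm 0%MM.
  rewrite mulr1 (bigD1_seq 0%MM) ?msupp_uniq ?mcoeff_msupp //= mdeg0 eqxx.
  rewrite mcoeffZ mcoeffX eqxx mulr1 big1 ?addr0 // => m' m'0.
  by case: ifP => //; rewrite mdeg_eq0 (negPf m'0).
rewrite mulr0 big1 // => m' _; case: ifP => //; rewrite mdeg_eq0 => /eqP ->.
by rewrite mcoeffZ mcoeffX eq_sym (negPf m0) mulr0.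
Qed.

Lemma field_avoid (s : seq K) : exists c, c \notin s.
Proof.
have [c nc] := closed_nonrootP _ (monic_neq0 (monic_prod_XsubC s predT id)).
by exists c; move: nc; rewrite root_prod_XsubC.
Qed.

(* Each ideal contains at most one member of the pencil u + c v. *)
Lemma pencil_avoid (T : eqType) (r : seq T) (F : T -> set S) u v :
  (forall i, i \in r -> is_ideal (F i)) -> (forall i, i \in r -> ~ F i u) ->
  exists s : seq K, forall c, c \notin s -> forall i, i \in r -> ~ F i (u + c *: v).
Proof.
elim: r => [|i r IH] iF nF; first by exists [::].
have [|j jr|s sP] := IH; [by move=> j jr; apply: iF; rewrite inE jr orbT
  | by apply: nF; rewrite inE jr orbT|].
have iFi : is_ideal (F i) by apply: iF; rewrite mem_head.
have [[c0 Fc0]|nc] := pselect (exists c, F i (u + c *: v)).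
  exists (c0 :: s) => c; rewrite inE negb_or => /andP[cc0 cs] j.
  rewrite inE => /predU1P[->|jr] Fc; last by apply: (sP c cs j).
  apply: (nF i (mem_head _ _)); have Fv : F i v.
    apply: (idealZK iFi (c := c - c0)); first by rewrite subr_eq0.
    by have := idealB iFi Fc Fc0; rewrite scalerBl opprD addrACA subrr add0r.
  exact: ideal_addr iFi (idealZ c0 iFi Fv) Fc0.
exists s => c cs j; rewrite inE => /predU1P[-> Fc|jr]; last exact: (sP c cs j).
by apply: nc; exists c.
Qed.

(** Prime avoidance for arbitrary ideals, K being infinite: with u outside the previous ideals and v
    outside [F i], a general u + c v with c nonzero is outside all of them. *)
Lemma ideal_avoid (T : eqType) (r : seq T) (F : T -> set S) P : is_ideal P ->
  (forall i, i \in r -> is_ideal (F i)) -> (forall i, i \in r -> ~ P `<=` F i) ->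
  exists2 u, P u & forall i, i \in r -> ~ F i u.
Proof.
move=> iP; elim: r => [|i r IH] iF nF; first by exists 0; [exact: (ideal0 iP) | by []].
have iF' j : j \in r -> is_ideal (F j) by move=> jr; apply: iF; rewrite inE jr orbT.
have [||u Pu nu] := IH; [exact: iF' | by move=> j jr; apply: nF; rewrite inE jr orbT|].
have iFi : is_ideal (F i) by apply: iF; rewrite mem_head.
have [Fu|nFu] := pselect (F i u); last first.
  by exists u => // j; rewrite inE => /predU1P[->|/nu].
have /existsNP[v /not_implyP[Pv nv]] := nF i (mem_head _ _).
have [s sP] := pencil_avoid v iF' nu; have [c] := field_avoid (0 :: s).
rewrite inE negb_or => /andP[c0 cs]; exists (u + c *: v).
  by apply: (idealD iP) => //; apply: (idealZ _ iP).
move=> j; rewrite inE => /predU1P[->|jr]; last exact: sP.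
rewrite addrC => /(ideal_addr iFi Fu) /(idealZK iFi c0); exact: nv.
Qed.

(** P has height at most n <= 3, so the local dimension is at most one. In dimension zero the empty
    sequence works. In dimension one P lies in no associated prime of T, and an element of P outside
    all of them is regular. *)
Lemma pure_locally_CM T : (n <= 3)%N -> pure_codim2 T -> locally_CM T.
Proof.
move=> n3 pT P pP hP TP [i0 nX]; have iP := prime_ideal pP.
have iT := pure_ideal pT.
have bound k : prime_chain T P k -> (k <= 1)%N.
  move=> /(pure_chain pT)[P0 [[_ c2 _] _ c]].
  by have := homogeneous_chain_dim hP nX (prime_chain_cat c2 c); lia.
have [c1|nc1] := pselect (prime_chain T P 1); last first.
  by exists [::]; split=> //; split=> //; exact/prime_chain0.
have [m [Q [A [hQ TE]]]] := pT.
have [||u Pu nu] := @ideal_avoid _ (enum A) (fun i => radical (Q i)) P iP.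
- by move=> i; rewrite mem_enum => /hQ[/primary_radical_prime/prime_ideal].
- move=> i; rewrite mem_enum => /hQ[_ [pQ _ nc3]] PQ; apply: nc3.
  have [P0 [[_ c2 _] _ c]] := pure_chain pT c1.
  exact: prime_chain_up (prime_chain_cat c2 c) pQ PQ.
have {}nu i : A i -> ~ radical (Q i) u by move=> Ai; apply: nu; rewrite mem_enum.
exists [:: u]; split=> [x /=|k a|]; last 1 first.
- by split=> // /bound.
- by rewrite inE => /eqP ->.
rewrite ltnS leqn0 => /eqP -> J [t [nt Jt]].
have JT : J `<=` T by apply: ideal_gen_min => // x [].
have [|i Ai|v [nv Qv]] := @loc_seq _ P _ A Q a pP.
- by move=> i /hQ[/primary_ideal].
- have [pQ _] := hQ _ Ai; have [QP|/existsNP[v /not_implyP[Qv nv]]] := pselect (Q i `<=` P).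
    have : Q i (a * (t * u)).
      rewrite mulrC -mulrA; move: Ai; move: (JT _ Jt); rewrite TE; apply.
    have [_ _ QM] := pQ; case/QM => [|rtu]; first exact: sub_loc.
    have pr := primary_radical_prime pQ.
    case: (primeM pr rtu) => [/(radical_prime_sub pP QP)//|/(nu _ Ai)//].
  by apply: loc_out Qv nv => //; apply: primary_ideal.
exists v; split=> //; apply: sub_ideal_gen; left; rewrite TE => i; exact: Qv.
Qed.

End ProjectiveTop.

#[local] Opaque jac ideal_of.

Lemma radical_mul_reg (R : comNzRingType) (T : set R) g : (forall v, T (g * v) -> T v) ->
  forall v, radical T (g * v) -> radical T v.
Proof.
move=> gT v [k]; rewrite exprMn => Tk; exists k; elim: {1}k Tk => [|l IH]; first by rewrite expr0 mul1r.
by rewrite exprS -mulrA => /gT.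
Qed.

Lemma projective_unmixed (K : closedFieldType) n (f g x : {mpoly K[n.+1]}) : (0 < n)%N ->
  f != 0 -> meet_codim2 f g ->
  (forall P, ht2 P -> loc (ideal_of [:: f; g]) P x) -> ideal_of [:: f; g] x.
Proof. by case: n f g x => // n f g x _; apply: complete_intersection_unmixed. Qed.

Section LinkIdeal.
Variables (K : closedFieldType) (n : nat).
Notation S := {mpoly K[n.+1]}.

(** As f is in T, an element u f + v g of T has v g in T, and regularity of g modulo T puts v in
    T. *)
Lemma link_inter (T : set S) (f g : S) : is_ideal T -> T f -> (forall v, T (g * v) -> T v) ->
  T `&` ideal_of [:: f; g] = double_link_ideal T f g.
Proof.
move=> iT Tf gT; apply/seteqP; split=> [x [Tx /ideal_of2[u [v E]]]|x [q Tq [r ->]]].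
  exists v; last by exists u; rewrite E addrC [v * g]mulrC.
  by apply: gT; rewrite mulrC; apply: (ideal_addr iT (idealMl u iT Tf)); rewrite addrC -E.
split; first by apply: (idealD iT); apply: (idealMl _ iT).
by apply: (iffRL (ideal_of2 _ _ _)); exists r, q; rewrite addrC [g * q]mulrC.
Qed.

(** The hypothesis keeps the singular locus of h away from k = 0, so [no_projective_zero] applies to
    [jac h] and k. *)
Lemma singular_chain (char0 : [pchar K] =i pred0) (h k : S) d e P :
  (0 < d)%N -> h \is d.-homog -> (0 < e)%N -> k \is e.-homog ->
  (forall a : 'I_n.+1 -> K, (exists i, a i != 0) -> h.@[a] = 0 -> k.@[a] = 0 ->
     exists i, (h^`M(i)).@[a] != 0) ->
  is_prime P -> jac h `<=` P -> prime_chain [set 0] P n.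
Proof.
move=> d0 hd e0 ke sm pP JP.
apply: (no_projective_zero (jac_homogeneous char0 hd) pP JP e0 ke) => a Ja ka i.
apply/eqP; apply: contrapT => /negP ai.
have [|j] := sm a _ (Ja _ (jac_euler char0 d0 hd)) ka; first by exists i.
by rewrite Ja ?eqxx //; exact: mem_jac.
Qed.

Lemma jac_factor (h u : S) P : is_prime P -> P h -> ~ P u -> jac (h * u) `<=` P -> jac h `<=` P.
Proof.
move=> pP Ph nu JP; have iP := prime_ideal pP; apply: (jac_min iP) => i.
have := JP _ (mem_jac i); rewrite mderivM => /(ideal_addr iP (idealMr _ iP Ph)).
by case/(primeM pP).
Qed.

Lemma dhomog_value0 (h : S) d : (0 < d)%N -> h \is d.-homog -> h@_0%MM = 0.
Proof.
move=> d0 /dhomogP hd; apply: memN_msupp_eq0; apply/negP => /hd /=.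
by rewrite mdeg0 => E; rewrite -E in d0.
Qed.

End LinkIdeal.

(** * Arrangements *)

Section Arrangement.
Variables (K : closedFieldType) (char0 : [pchar K] =i pred0) (n : nat) (n_ge2 : (2 <= n)%N).
Notation S := {mpoly K[n.+1]}.
Variables (s : nat) (f_ : 'I_s -> S) (d_ : 'I_s -> nat) (i0 : 'I_s) (g : S) (dg : nat).
Hypotheses (f_neq0 : forall i, f_ i != 0) (d_gt0 : forall i, (0 < d_ i)%N).
Hypotheses (f_homog : forall i, f_ i \is (d_ i).-homog) (dg_gt0 : (0 < dg)%N).
Hypothesis g_homog : g \is dg.-homog.
Hypothesis hi : forall i, smooth_complete_intersection [tuple f_ i; g].
Hypothesis hii : forall i j, i != j -> smooth_complete_intersection [tuple f_ i; f_ j].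
Hypothesis hiii : forall i j, i != j -> has_codim (ideal_of [:: f_ i; f_ j; g]) 3.
Hypothesis g_smooth : n = 2%N -> smooth_complete_intersection [tuple g].

Variables (f : S) (u : 'I_s -> S).
Hypotheses (f_def : f = \prod_(i < s) f_ i).
Hypothesis u_def : forall i, u i = \prod_(j < s | j != i) f_ j.

Lemma arr_split i : f = f_ i * u i.
Proof. by rewrite f_def u_def (bigD1 i). Qed.

Lemma arr_neq0 : f != 0.
Proof. by rewrite f_def; apply/prodf_neq0 => i _; apply: f_neq0. Qed.

Lemma arr_homog : f \is (\sum_(i < s) d_ i).-homog.
Proof.
rewrite f_def; elim/big_rec2: _ => [|i x y _ IH]; first exact: dhomog1.
exact: dhomogM.
Qed.

Lemma arr_deg_gt0 : (0 < \sum_(i < s) d_ i)%N.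
Proof. by rewrite (bigD1 i0) //= addn_gt0 d_gt0. Qed.

Lemma jac_arr : jac f f.
Proof. exact: (jac_euler char0 arr_deg_gt0 arr_homog). Qed.

Lemma jac_arrg : jac (f * g) (f * g).
Proof.
apply: (jac_euler char0 _ (dhomogM arr_homog g_homog)).
by rewrite addn_gt0 dg_gt0 orbT.
Qed.

Lemma codim_chain (l : seq S) c P : has_codim (ideal_of l) c -> is_prime P ->
  {in l, forall x, P x} -> prime_chain [set 0] P c.
Proof.
move=> [h _] pP lP; apply: h => //.
by apply: ideal_of_min => //; exact: prime_ideal.
Qed.

Lemma fg_chain i P : is_prime P -> P (f_ i) -> P g -> prime_chain [set 0] P 2.
Proof.
move=> pP Pf Pg; apply: (codim_chain (hi i).1 pP) => x.
by rewrite !inE => /orP[]/eqP ->.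
Qed.

Lemma ff_chain i j P : i != j -> is_prime P -> P (f_ i) -> P (f_ j) -> prime_chain [set 0] P 2.
Proof.
move=> ij pP Pi Pj; apply: (codim_chain (hii ij).1 pP) => x.
by rewrite !inE => /orP[]/eqP ->.
Qed.

Lemma ffg_chain i j P : i != j -> is_prime P -> P (f_ i) -> P (f_ j) -> P g ->
  prime_chain [set 0] P 3.
Proof.
move=> ij pP Pi Pj Pg; apply: (codim_chain (hiii ij) pP) => x.
by rewrite !inE => /or3P[]/eqP ->.
Qed.

Lemma arr_prime P : is_prime P -> P f -> exists i, P (f_ i).
Proof. by move=> pP; rewrite f_def => /(prime_prod pP)[i _ Pi]; exists i. Qed.

Lemma others_prime i P : is_prime P -> P (u i) -> exists2 j, i != j & P (f_ j).
Proof. by move=> pP; rewrite u_def => /(prime_prod pP)[j ji Pj]; exists j; rewrite // eq_sym. Qed.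

Lemma others_out i P : ht2 P -> P g -> P (f_ i) -> ~ P (u i).
Proof.
move=> [pP _ n3] Pg Pi /(others_prime pP)[j ij Pj].
by apply: n3; apply: ffg_chain ij pP Pi Pj Pg.
Qed.

Lemma arr_meet_codim2 : meet_codim2 f g.
Proof. by move=> P pP /(arr_prime pP)[i Pi]; apply: fg_chain Pi. Qed.

(** A nonzero 2 x 2 minor has a nonzero entry in each row. *)
Lemma fg_smooth i (a : 'I_n.+1 -> K) : (exists j, a j != 0) -> (f_ i).@[a] = 0 -> g.@[a] = 0 ->
  (exists j, ((f_ i)^`M(j)).@[a] != 0) /\ (exists j, (g^`M(j)).@[a] != 0).
Proof.
move=> a0 fa ga; have [j [k]] := smooth_point (hi i) a0 fa ga.
rewrite /minor mevalB !mevalM => nm.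
have [nf|nf] := eqVneq ((f_ i)^`M(j)).@[a] 0; have [ng|ng] := eqVneq (g^`M(j)).@[a] 0.
- by move: nm; rewrite nf ng mul0r mulr0 subrr eqxx.
- split; last by exists j.
  by exists k; apply: contra_neq nm => ->; rewrite nf !mul0r subrr.
- split; first by exists j.
  by exists k; apply: contra_neq nm => ->; rewrite ng !mulr0 subrr.
- by split; exists j.
Qed.

Lemma jac_f_chain i P : is_prime P -> jac (f_ i) `<=` P -> prime_chain [set 0] P n.
Proof.
move=> pP JP; apply: (singular_chain char0 (d_gt0 i) (f_homog i) dg_gt0 g_homog _ pP JP).
by move=> a a0 fa ga; have [] := fg_smooth a0 fa ga.
Qed.

Lemma jac_g_chain P : is_prime P -> jac g `<=` P -> prime_chain [set 0] P n.
Proof.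
move=> pP JP; apply: (singular_chain char0 dg_gt0 g_homog (d_gt0 i0) (f_homog i0) _ pP JP).
by move=> a a0 ga fa; have [] := fg_smooth a0 fa ga.
Qed.

(** A prime over [jac f] contains some f_i. If it contains another factor as well, the codimension
    of (f_i, f_j) suffices; if not, it contains [jac (f_ i)] and has height at least n. *)
Lemma jac_arr_height : height_ge (jac f) 2.
Proof.
move=> P pP JP; have [i Pi] := arr_prime pP (JP _ jac_arr).
have [Pu|nu] := pselect (P (u i)).
  by have [j ij Pj] := others_prime pP Pu; apply: ff_chain ij pP Pi Pj.
apply: (prime_chain_le n_ge2); apply: (@jac_f_chain i) => //.
by apply: (jac_factor pP Pi nu); rewrite -arr_split.
Qed.

Lemma jac_arrg_height : height_ge (jac (f * g)) 2.
Proof.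
move=> P pP JP; have [Pg|ng] := pselect (P g).
  have [Pf|nf] := pselect (P f); first exact: arr_meet_codim2.
  apply: (prime_chain_le n_ge2); apply: jac_g_chain => //.
  by apply: (jac_factor pP Pg nf); rewrite mulrC.
apply: jac_arr_height => //; apply: (jac_factor pP _ ng JP).
by case: (primeM pP (JP _ jac_arrg)).
Qed.

(** For n >= 3 a prime containing all derivatives of g has height at least n, which is too large.
    For n = 2 a zero of P would be a singular point of the plane curve g = 0. *)
Lemma g_gradient P : ht2 P -> P g -> exists j, ~ P g^`M(j).
Proof.
move=> hP Pg; have [pP _ n3] := hP; apply: contrapT => nD.
have PD j : P g^`M(j) by apply: contrapT => ?; apply: nD; exists j.
have [n2|n2] := eqVneq n 2%N; last first.
  apply: n3; apply: (@prime_chain_le _ _ _ 3 n); first by lia.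
  by apply: jac_g_chain => //; apply: jac_min => //; exact: prime_ideal.
have [i nX] := ht2_var n_ge2 hP; have [a [Pa]] := nullstellensatz pP nX.
rewrite mevalXU => ai; have [_ sm] := g_smooth n2.
have := sm a (ex_intro _ i ai); rewrite (_ : \matrix_(_, _) _ = 0).
  rewrite mxrank0 => h; suff: 0%N = 1%N by [].
  by apply: h => -[[|//] Hk]; rewrite (tnth_nth 0); apply: Pa.
by apply/matrixP => -[[|//] Hk] j; rewrite !mxE (tnth_nth 0); apply: Pa.
Qed.

Lemma mem_pair1 : ideal_of [:: f; g] f.
Proof. by apply: mem_ideal_of; rewrite mem_head. Qed.

Lemma mem_pair2 : ideal_of [:: f; g] g.
Proof. by apply: mem_ideal_of; rewrite !inE eqxx orbT. Qed.

Lemma loc_jac_out P (h : S) j : is_prime P -> ~ P h^`M(j) -> forall x, loc (jac h) P x.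
Proof. by move=> pP nD x; apply: loc_out nD => //; [exact: jac_ideal | exact: mem_jac]. Qed.

Lemma loc_arr_full P : ht2 P -> P g -> forall x, loc (jac f) P x.
Proof.
move=> hP Pg x; have [pP _ _] := hP; have [Pf|nf] := pselect (P f); last first.
  exact: (loc_out _ pP (jac_ideal f) jac_arr nf).
have [i Pi] := arr_prime pP Pf; have nu := others_out hP Pg Pi.
have [v nX] := ht2_var n_ge2 hP.
have [j [k nm]] := smooth_minor (hi i) pP Pi Pg nX.
have [[l nD] _] := minor_out pP nm; rewrite (arr_split i) loc_jac_mul //.
- exact: loc_jac_out nD _.
- exact: (jac_euler char0 (d_gt0 i) (f_homog i)).
- by rewrite -arr_split; exact: jac_arr.
Qed.

Lemma loc_pair i P : ht2 P -> P g -> P (f_ i) ->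
  loc (ideal_of [:: f_ i; g]) P = loc (ideal_of [:: f; g]) P.
Proof.
move=> hP Pg Pi; have [pP _ _] := hP; have nu := others_out hP Pg Pi.
have i1 := ideal_of_ideal [:: f_ i; g]; have i2 := ideal_of_ideal [:: f; g].
apply/seteqP; split; apply: (loc_sub pP).
  apply: (ideal_of_min (loc_ideal pP i2)) => x; rewrite !inE => /orP[]/eqP ->.
    by exists (u i); split=> //; rewrite mulrC -arr_split; apply: mem_ideal_of; rewrite mem_head.
  by apply: (sub_loc pP); apply: mem_ideal_of; rewrite !inE eqxx orbT.
apply: (ideal_of_min (loc_ideal pP i1)) => x; rewrite !inE => /orP[]/eqP ->; apply: (sub_loc pP).
  by rewrite (arr_split i); apply: (idealMr _ i1); apply: mem_ideal_of; rewrite mem_head.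
by apply: mem_ideal_of; rewrite !inE eqxx orbT.
Qed.

(* By cases: if g is a unit at P, Jac(f g) and Jac(f) agree there and (f, g) is
   the unit ideal; if only f is, then Jac(f g) agrees with Jac(g), which is
   trivial; if neither is, exactly one f_i is not and Jac(f g) = (f_i, g). *)
Lemma loc_arrg P : ht2 P -> loc (jac (f * g)) P = loc (jac f) P `&` loc (ideal_of [:: f; g]) P.
Proof.
move=> hP; have [pP _ _] := hP; have i2 := ideal_of_ideal [:: f; g].
have [Pg|ng] := pselect (P g); last first.
  rewrite [LHS](loc_jac_mul pP ng jac_arr jac_arrg); apply/seteqP; split=> [x lx|x [lx _]].
    by split; [exact: lx | exact: (loc_out _ pP i2 mem_pair2 ng)].
  exact: lx.
have full := loc_arr_full hP Pg; have [Pf|nf] := pselect (P f); last first.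
  have Jg : jac g g by exact: (jac_euler char0 dg_gt0 g_homog).
  have Jgf : jac (g * f) (g * f) by rewrite mulrC; exact: jac_arrg.
  rewrite [in LHS]mulrC [LHS](loc_jac_mul pP nf Jg Jgf).
  have [j nD] := g_gradient hP Pg; apply/seteqP; split=> [x _|x _].
    by split; [exact: full | exact: (loc_out _ pP i2 mem_pair1 nf)].
  exact: (loc_jac_out pP nD).
have [i Pi] := arr_prime pP Pf; have nu := others_out hP Pg Pi.
have [v nX] := ht2_var n_ge2 hP.
have [j [k nm]] := smooth_minor (hi i) pP Pi Pg nX.
have E : f * g = f_ i * g * u i by rewrite (arr_split i) mulrAC.
have Jig : jac (f_ i * g) (f_ i * g).
  apply: (jac_euler char0 _ (dhomogM (f_homog i) g_homog)).
  by rewrite addn_gt0 dg_gt0 orbT.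
have Ji : jac (f_ i * g * u i) (f_ i * g * u i) by rewrite -E; exact: jac_arrg.
rewrite [in LHS]E [LHS](loc_jac_mul pP nu Jig Ji) [LHS](loc_jac_minor pP nm).
rewrite [LHS](loc_pair hP Pg Pi).
apply/seteqP; split=> [x lx|x [_ lx]]; last exact: lx.
by split; [exact: full | exact: lx].
Qed.

Lemma arr_unmixed x : (forall P, ht2 P -> loc (ideal_of [:: f; g]) P x) -> ideal_of [:: f; g] x.
Proof.
exact: (projective_unmixed (ltnW n_ge2) arr_neq0 arr_meet_codim2).
Qed.

(** By unmixedness it is enough to look at height two primes, where (f, g) is trivial or agrees with
    a single (f_i, g). *)
Lemma pair_inter : \bigcap_(i in [set: 'I_s]) ideal_of [:: f_ i; g] = ideal_of [:: f; g].
Proof.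
have i2 := ideal_of_ideal [:: f; g].
apply/seteqP; split=> [x Ix|x /ideal_of2[a [b ->]] i _]; last first.
  by apply: (iffRL (ideal_of2 _ _ _)); exists (a * u i), b; rewrite (arr_split i); ring.
apply: arr_unmixed => P hP; have [pP _ _] := hP.
have [Pg|ng] := pselect (P g); last first.
  exact: (loc_out _ pP i2 mem_pair2 ng).
have [Pf|nf] := pselect (P f); last first.
  exact: (loc_out _ pP i2 mem_pair1 nf).
have [i Pi] := arr_prime pP Pf; rewrite -(loc_pair hP Pg Pi).
by apply: (sub_loc pP); apply: Ix.
Qed.

(** At a height two prime P containing f and g, smoothness makes (f_i, g) generate P locally, so no
    nilpotents remain there. *)
Lemma pair_radical : radical (ideal_of [:: f; g]) = ideal_of [:: f; g].
Proof.
have i2 := ideal_of_ideal [:: f; g].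
apply/seteqP; split=> [x [k Ix]|]; last exact: sub_radical.
apply: arr_unmixed => P hP; have [pP _ _] := hP.
have [Pg|ng] := pselect (P g); last first.
  exact: (loc_out _ pP i2 mem_pair2 ng).
have [Pf|nf] := pselect (P f); last first.
  exact: (loc_out _ pP i2 mem_pair1 nf).
have Px : P x.
  apply: (primeX (k := k) pP); apply: (ideal_of_min (prime_ideal pP)) Ix => y.
  by rewrite !inE => /orP[]/eqP ->.
have [i Pi] := arr_prime pP Pf; rewrite -(loc_pair hP Pg Pi).
have [v nX] := ht2_var n_ge2 hP.
exact: complete_intersection_local (hi i) hP Pi Pg nX Px.
Qed.

Lemma arr_regular : regular_sequence [:: f; g].
Proof.
split=> [[|[|k]] a //= _|/ideal_of2[a [b E]]].
- move=> /ideal_of_nil/eqP; rewrite mulf_eq0 (negPf arr_neq0) => /eqP ->.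
  exact: (iffRL (ideal_of_nil _)).
- exact: meet_codim2_regular arr_neq0 arr_meet_codim2.
(* Forms of positive degree have no constant coefficient, so 1 is not in (f, g). *)
have := congr1 (mcoeff (0%MM : 'X_{1..n.+1}) : {rmorphism S -> K}) E.
rewrite rmorph1 rmorphD !rmorphM /= (dhomog_value0 arr_deg_gt0 arr_homog).
by rewrite (dhomog_value0 dg_gt0 g_homog) !mulr0 addr0 => /eqP; rewrite oner_eq0.
Qed.

Section TopIdeals.
Variables Tf Tfg : set S.
Hypotheses (topf : is_top (jac f) Tf) (topfg : is_top (jac (f * g)) Tfg).

Lemma top_inter : Tfg = Tf `&` ideal_of [:: f; g].
Proof.
apply/seteqP; split=> [x /(topP _ jac_arrg_height topfg) lx|x [/(topP _ jac_arr_height topf) lx Ix]].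
  have {}lx P : ht2 P -> (loc (jac f) P `&` loc (ideal_of [:: f; g]) P) x.
    by move=> hP; rewrite -(loc_arrg hP); exact: lx.
  split; last by apply: arr_unmixed => P /lx[].
  by apply/(topP _ jac_arr_height topf) => P /lx[].
apply/(topP _ jac_arrg_height topfg) => P hP; rewrite (loc_arrg hP); split; first exact: lx.
by apply: sub_loc Ix; case: hP.
Qed.

Lemma top_mem : Tf f.
Proof.
apply/(topP _ jac_arr_height topf) => P [pP _ _].
by apply: (sub_loc pP); exact: jac_arr.
Qed.

(** At a height two prime either g is a unit or [jac f] is trivial. *)
Lemma top_mul_reg v : Tf (g * v) -> Tf v.
Proof.
move=> /(topP _ jac_arr_height topf) lx; apply/(topP _ jac_arr_height topf) => P hP.
have [pP _ _] := hP; have [Pg|ng] := pselect (P g); first exact: loc_arr_full.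
exact: locM ng (lx P hP).
Qed.

Lemma top_link : Tfg = double_link_ideal Tf f g.
Proof.
rewrite top_inter link_inter //; [exact: pure_ideal (top_pure topf) | exact: top_mem | exact: top_mul_reg].
Qed.

Lemma radical_top_inter : radical Tfg = radical Tf `&` ideal_of [:: f; g].
Proof.
rewrite top_inter radical_setI ?pair_radical //; last exact: ideal_of_ideal.
exact: pure_ideal (top_pure topf).
Qed.

Lemma radical_top_link : radical Tfg = double_link_ideal (radical Tf) f g.
Proof.
rewrite radical_top_inter link_inter //; last exact: radical_mul_reg top_mul_reg.
  exact/radical_ideal/pure_ideal/top_pure/topf.
exact/sub_radical/top_mem.
Qed.

Lemma top_stable x : Tf x -> Tf (scale_vars n.+1 2%:R x).
Proof.
apply: (top_scale_vars char0 jac_arr_height topf) => y.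
exact: jac_scale_vars arr_homog.
Qed.

Lemma radical_top_stable x : radical Tf x -> radical Tf (scale_vars n.+1 2%:R x).
Proof. by move=> [k /top_stable Tk]; exists k; rewrite -rmorphXn. Qed.

(** Stated for any pure T so that it serves both the top part and its radical. *)
Lemma link_of_pure T J : pure_codim2 T -> (forall x, T x -> T (scale_vars n.+1 2%:R x)) -> T f ->
  J = double_link_ideal T f g ->
  [/\ J = double_link_ideal T f g, T = setT \/ codim_two_ideal T, double_link_step T f g J
    & (n <= 3)%N \/ locally_CM T -> basic_double_linkage T f g J].
Proof.
move=> pT sT Tf1 JE; have c2 := pure_codim_two_ideal char0 n_ge2 pT sT.
have step : double_link_step T f g J.
  split=> //; [split; [exists (\sum_i d_ i)%N; exact: arr_homog | by exists dg] | exact: arr_regular].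
split=> // cm; split=> //; case: c2 => [->|c2]; [by left | right; split=> //].
by case: cm => // n3; apply: pure_locally_CM.
Qed.

Lemma arr_double_linkage :
  (Tfg = Tf `&` \bigcap_(i in [set: 'I_s]) ideal_of [:: f_ i; g] /\
   \bigcap_(i in [set: 'I_s]) ideal_of [:: f_ i; g] = ideal_of [:: f; g]) /\
  [/\ Tfg = double_link_ideal Tf f g, Tf = setT \/ codim_two_ideal Tf,
      double_link_step Tf f g Tfg
    & (n <= 3)%N \/ locally_CM Tf -> basic_double_linkage Tf f g Tfg] /\
  radical Tfg = radical Tf `&` \bigcap_(i in [set: 'I_s]) ideal_of [:: f_ i; g] /\
  [/\ radical Tfg = double_link_ideal (radical Tf) f g,
      radical Tf = setT \/ codim_two_ideal (radical Tf),
      double_link_step (radical Tf) f g (radical Tfg)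
    & (n <= 3)%N \/ locally_CM (radical Tf) ->
      basic_double_linkage (radical Tf) f g (radical Tfg)].
Proof.
have pT := top_pure topf; rewrite pair_inter; split; [|split; [|split]].
- by split=> //; exact: top_inter.
- exact: (link_of_pure pT top_stable top_mem top_link).
- exact: radical_top_inter.
- apply: (link_of_pure (radical_pure pT) radical_top_stable _ radical_top_link).
  exact: (sub_radical top_mem).
Qed.

End TopIdeals.

End Arrangement.

(** A nonzero constant g would make (f, g) the unit ideal, whose height exceeds every bound. *)
Lemma form_pos_degree (K : closedFieldType) n (f g : {mpoly K[n.+1]}) : is_form g ->
  has_codim (ideal_of [:: f; g]) 2 -> exists2 d, (0 < d)%N & g \is d.-homog.
Proof.
move=> [[|d] gd] [_ n3]; last by exists d.+1.
(* Zero is homogeneous of every degree, so degree 1 can be chosen. *)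
have [g0|g0] := eqVneq g 0; first by exists 1%N => //; rewrite g0 dhomog0.
exfalso; apply: n3 => P pP IP; exfalso; apply: (prime1 pP).
have Pg : P g by apply: IP; apply: mem_ideal_of; rewrite !inE eqxx orbT.
move: Pg; rewrite (msize1_polyC (dhomog_msize_le gd)) => Pc.
have c0 : g@_0 != 0.
  by apply: contra_neq g0 => c0; rewrite (msize1_polyC (dhomog_msize_le gd)) c0 mpolyC0.
rewrite -mpolyC1 -(mulVf c0) mpolyCM; exact: (idealMl _ (prime_ideal pP)).
Qed.

Theorem corollary4p6 (K : closedFieldType) (char0 : [pchar K] =i pred0)
  (n : nat) (n_ge2 : (2 <= n)%N)
  (s : nat) (s_gt0 : (0 < s)%N) (f_ : 'I_s -> {mpoly K[n.+1]})
  (arr : hypersurface_arrangement f_)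
  (g : {mpoly K[n.+1]}) (g_form : is_form g)
  (hi : forall i, smooth_complete_intersection [tuple f_ i; g])
  (hii : forall i j, i != j -> smooth_complete_intersection [tuple f_ i; f_ j])
  (hiii : forall i j, i != j -> has_codim (ideal_of [:: f_ i; f_ j; g]) 3)
  (* automatic for n >= 3; without it a node of the plane curve g = 0 lying
     outside f = 0 is a counterexample to (a) *)
  (g_smooth : n = 2%N -> smooth_complete_intersection [tuple g]) :
  let f := \prod_(i < s) f_ i in
  (* V(Tf) need not be locally Cohen-Macaulay when n >= 4, whence the side
     condition on the last clause of (b) and of (c) *)
  forall Tf Tfg : set {mpoly K[n.+1]},
    is_top (jac f) Tf -> is_top (jac (f * g)) Tfg ->
    (* (a) *)
    (Tfg = Tf `&` \bigcap_(i in [set: 'I_s]) ideal_of [:: f_ i; g] /\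
     \bigcap_(i in [set: 'I_s]) ideal_of [:: f_ i; g] = ideal_of [:: f; g]) /\
    (* (b) *)
    [/\ Tfg = double_link_ideal Tf f g,
        Tf = setT \/ codim_two_ideal Tf,
        double_link_step Tf f g Tfg
      & (n <= 3)%N \/ locally_CM Tf -> basic_double_linkage Tf f g Tfg] /\
    (* (c) *)
    radical Tfg =
      radical Tf `&` \bigcap_(i in [set: 'I_s]) ideal_of [:: f_ i; g] /\
    [/\ radical Tfg = double_link_ideal (radical Tf) f g,
        radical Tf = setT \/ codim_two_ideal (radical Tf),
        double_link_step (radical Tf) f g (radical Tfg)
      & (n <= 3)%N \/ locally_CM (radical Tf) ->
        basic_double_linkage (radical Tf) f g (radical Tfg)].
Proof.
move=> f Tf Tfg topf topfg.
have f_neq0 i : f_ i != 0 by case: (arr.1 i).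
have /choice[d dP] : forall i, exists d, (0 < d)%N /\ f_ i \is d.-homog.
  by move=> i; case: (arr.1 i) => _ [d d0 fd]; exists d.
have [dg dg0 gd] := form_pos_degree g_form (hi (Ordinal s_gt0)).1.
exact: (arr_double_linkage char0 n_ge2 (Ordinal s_gt0) f_neq0 (fun i => (dP i).1)
  (fun i => (dP i).2) dg0 gd hi hii hiii g_smooth
  erefl (fun=> erefl) topf topfg).
Qed.
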